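(* For every $c'\in(0,1/2)$ there is a constant $c>0$, depending only on $c'$, such that the following holds. Let $n\ge2$ and $1\le k<n$ be integers with $c'n\le k\le(1-c')n$, and let $f:\binom{[n]}{k}\to\mathbb{R}$ be a function on the slice $\binom{[n]}{k}=\{x\in\{0,1\}^n:\sum_{i=1}^nx_i=k\}$ of the Boolean cube. Then, for every $\eta\in[0,1)$, $$ \mathcal{S}^s_\eta(f)\;\le\;7\left(\frac{1}{n-1}\sum_{1\le i<j\le n}I_{\tau_{ij}}(f)^2\right)^{c\eta}\|f\|_2^{2-2c\eta}. $$
   Context: $\mu$ is the uniform probability measure on $\binom{[n]}{k}$; norms $\|\cdot\|_p$ are those of $L^p(\mu)$ and $\mathrm{Var}_\mu(f)=\int f^2d\mu-(\int f\,d\mu)^2$. For $1\le i<j\le n$, $x^{\tau_{ij}}$ is obtained from $x$ by switching the coordinates $i$ and $j$, $D_{\tau_{ij}}f(x)=f(x^{\tau_{ij}})-f(x)$, and the influence of the transposition $\tau_{ij}$ on $f$ is $I_{\tau_{ij}}(f)=\|D_{\tau_{ij}}f\|_1$. The (rescaled) Dirichlet form is $\mathcal{E}'(f,f)=\frac{1}{n-1}\sum_{1\le i<j\le n}\|D_{\tau_{ij}}f\|_2^2$, that is $\mathcal{E}'(f,f)=\int f(-L'f)\,d\mu$ with $L'=\frac{2}{n-1}\sum_{1\le i<j\le n}D_{\tau_{ij}}$ ($n$ times the generator $K-\mathrm{Id}$ of the random walk applying a uniformly chosen transposition); $P_t=e^{tL'}$, $t\ge0$. Let $\lambda'$ be the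 spectral gap constant, i.e. the largest constant such that $\lambda'\,\mathrm{Var}_\mu(f)\le\mathcal{E}'(f,f)$ for all $f$. Noise stability: $\mathcal{S}^s_\eta(f)=\mathrm{Var}_\mu(P_tf)$ where $t\ge0$ is defined by $e^{-2\lambda't}=1-\eta$ (this quantity does not depend on the normalization of the Dirichlet form). *)

(* Defs.v *)
From mathcomp Require Import all_boot all_order all_algebra perm.
From mathcomp Require Import all_classical all_reals all_analysis.

Set Implicit Arguments.
Unset Strict Implicit.
Unset Printing Implicit Defensive.

Import Order.TTheory GRing.Theory Num.Theory.
Import numFieldNormedType.Exports.
Local Open Scope classical_set_scope.
Local Open Scope ring_scope.

(* Bits are summed through the coercion of bool to nat. *)
Definition slice (n k : nat) : Type :=
  {x : {ffun 'I_n -> bool} | (\sum_(i < n) x i)%N == k}.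

Lemma switch_subproof (n k : nat) (i j : 'I_n) (x : slice n k) :
  (\sum_(l < n) [ffun l => val x (tperm i j l)] l)%N == k.
Proof.
rewrite -[X in _ == X](eqP (valP x)) [X in _ == X](reindex_perm (tperm i j)) /=.
by apply/eqP/eq_bigr => l _; rewrite ffunE.
Qed.

Definition switch (n k : nat) (i j : 'I_n) (x : slice n k) : slice n k :=
  exist _ [ffun l => val x (tperm i j l)] (switch_subproof i j x).

Section SliceFunctions.
Context {R : realType} {n k : nat}.
Implicit Types f : slice n k -> R.

Definition mean f : R := (\sum_(x : slice n k) f x) / #|{: slice n k}|%:R.

Definition norm (p : R) f : R := (mean (fun x => `|f x| `^ p)) `^ p^-1.

Definition variance f : R := mean (fun x => f x ^+ 2) - mean f ^+ 2.

Definition Dtau (i j : 'I_n) f : slice n k -> R :=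
  fun x => f (switch i j x) - f x.

Definition influence (i j : 'I_n) f : R := norm 1 (Dtau i j f).

Definition dirichlet f : R :=
  (n%:R - 1)^-1 *
  \sum_(i < n) \sum_(j < n | (i < j)%N) norm 2 (Dtau i j f) ^+ 2.

Definition generator f : slice n k -> R := fun x =>
  2 / (n%:R - 1) * \sum_(i < n) \sum_(j < n | (i < j)%N) Dtau i j f x.

(* The operator exponential e^(t generator), as a pointwise power series;
   it converges because the space of functions on the slice is
   finite-dimensional. *)
Definition semigroup (t : R) f : slice n k -> R := fun x =>
  limn (series (fun m : nat => t ^+ m / (m`!)%:R * iter m generator f x)).

End SliceFunctions.

(* For 0 < k < n the slice has at least two points, so that the set below is
   bounded above; it also contains 0 and is closed, so that its supremum is its
   largest element. *)
Definition spectral_gap (R : realType) (n k : nat) : R :=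
  sup [set l : R | forall f : slice n k -> R, l * variance f <= dirichlet f].

(* The t >= 0 such that e^(- 2 gap t) = 1 - eta: it exists and is unique for
   0 <= eta < 1 as soon as the spectral gap is positive, hence for 0 < k < n. *)
Definition noise_time (R : realType) (n k : nat) (eta : R) : R :=
  get [set t : R | 0 <= t /\ expR (- 2 * spectral_gap R n k * t) = 1 - eta].

Definition noise_stability (R : realType) (n k : nat) (eta : R)
    (f : slice n k -> R) : R :=
  variance (semigroup (noise_time n k eta) f).

(* Main.v *)
Require Import Defs.
From mathcomp Require Import all_boot all_order all_algebra perm.
From mathcomp Require Import all_classical all_reals all_analysis.
From mathcomp Require Import finset ring lra zify.

Set Implicit Arguments.
Unset Strict Implicit.
Unset Printing Implicit Defensive.

Import Order.TTheory GRing.Theory Num.Theory.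
Import numFieldNormedType.Exports.
Local Open Scope ring_scope.

(** Applying [Dtau i j] to a function produces a function antisymmetric in the
    coordinates i and j, on which the Laplacian of the slice is, up to an additive
    constant, the Laplacian in the n - 2 other coordinates. By induction this gives
    the eigenvalues of the Laplacian without harmonic polynomials, and, on pairing
    the equation of an eigenfunction h with h^3, a bound
    E h^4 <= K^d (E h^2)^2 in the d-th eigenspace, where K depends on c' only; the
    base case counts the points of an orbit, hence the ratio of the binomials
    (n choose k) and (n - 2d choose k - d). For a time s depending on K only, the
    heat semigroup P_s is therefore bounded from L^2 to L^4. Since P_t is
    a contraction of L^1 and commutes with [Dtau i j], the Poincare inequality at
    time 2 s yields Var(P_(2s) f)^2 <= 8 X |f|_2^2, X being the sum of squared
    influences over n - 1. Smaller times follow by log-convexity of t |-> Var(P_t f),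
    and the spectral gap, at most 4 / (c' (1 - c')), converts eta into a time. *)

(** * Swapping coordinates *)

Section Switch.
Context {n k : nat}.
Implicit Types (x y : slice n k) (i j a b l : 'I_n).

Lemma slice_inj x y : val x =1 val y -> x = y.
Proof. by move=> xy; apply/val_inj/ffunP. Qed.

Lemma switchE i j x l : val (switch i j x) l = val x (tperm i j l).
Proof. by rewrite /switch /= ffunE. Qed.

Lemma switchK i j : involutive (@switch n k i j).
Proof. by move=> x; apply: slice_inj => l; rewrite !switchE tpermK. Qed.

Lemma switchC i j x : switch i j x = switch j i x.
Proof. by apply: slice_inj => l; rewrite !switchE tpermC. Qed.

Lemma switch_same i j x : val x i = val x j -> switch i j x = x.
Proof.
by move=> e; apply: slice_inj => l; rewrite switchE; case: tpermP => [->|->|].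
Qed.

Lemma switch_conj i j a b x :
  switch i j (switch a b x) =
  switch (tperm i j a) (tperm i j b) (switch i j x).
Proof.
apply: slice_inj => l; rewrite !switchE; congr (val x _).
rewrite -{2}[l](tpermK i j) -(inj_tperm _ _ _ (@perm_inj _ (tperm i j))).
by rewrite tpermK.
Qed.

Definition weight (A : {set 'I_n}) x : nat := (\sum_(i in A) val x i)%N.

Lemma weightT x : weight setT x = k.
Proof. by rewrite -[RHS](eqP (valP x)); apply: eq_bigl => i; rewrite inE. Qed.

Lemma weight_switch (A : {set 'I_n}) i j x : i \in A -> j \in A ->
  weight A (switch i j x) = weight A x.
Proof.
move=> iA jA; rewrite /weight [RHS](reindex_perm (tperm i j)) /=.
apply: eq_big => [l|l _]; last by rewrite switchE.
by case: tpermP => [->|->|] //; rewrite iA jA.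
Qed.

Lemma weight_le (A : {set 'I_n}) x : (weight A x <= #|A|)%N.
Proof. by rewrite /weight -sum1_card; apply: leq_sum => i _; case: (val x i). Qed.

End Switch.

(** * The Laplacian and its spectrum *)

Section Operators.
Context {R : realType} {n k : nat}.
Implicit Types (x y : slice n k) (f g h : slice n k -> R) (i j : 'I_n).
Implicit Types A : {set 'I_n}.

Lemma sum_switch i j (f : slice n k -> R) :
  \sum_(x : slice n k) f (switch i j x) = \sum_(x : slice n k) f x.
Proof.
by rewrite [RHS](reindex_inj (can_inj (@switchK n k i j))).
Qed.

(** The switch preserves the sum and reverses the sign of [Dtau i j g], so [f] may be replaced by
    its antisymmetric part, which is minus half of [Dtau i j f]. *)
Lemma sum_mul_Dtau i j f g :
  \sum_(x : slice n k) f x * Dtau i j g x =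
  - 2^-1 * \sum_(x : slice n k) Dtau i j f x * Dtau i j g x.
Proof.
have e : \sum_(x : slice n k) f x * Dtau i j g x =
   \sum_(x : slice n k) f (switch i j x) * - Dtau i j g x.
  rewrite -(sum_switch i j); apply: eq_bigr => x _.
  by rewrite /Dtau switchK; ring.
apply: (@mulfI _ 2) => //; rewrite mulrDl mul1r {2}e -big_split /=.
rewrite mulrA mulrN divff // mulN1r -sumrN; apply: eq_bigr => x _.
by rewrite /Dtau; ring.
Qed.

(** Ordered pairs are summed, so each transposition counts twice; for [A := setT] this is n - 1
    times the generator. *)
Definition lapl A f x : R := \sum_(i in A) \sum_(j in A) Dtau i j f x.

Lemma lapl_switch A i j f x : i \in A -> j \in A ->
  lapl A (fun y => f (switch i j y)) x = lapl A f (switch i j x).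
Proof.
move=> iA jA; have tA l : (tperm i j l \in A) = (l \in A).
  by case: tpermP => [->|->|] //; rewrite iA jA.
rewrite /lapl [RHS](reindex_perm (tperm i j)); apply: eq_big => [a|a _].
  by rewrite tA.
rewrite [RHS](reindex_perm (tperm i j)); apply: eq_big => [b|b _].
  by rewrite tA.
by rewrite /Dtau switch_conj.
Qed.

Lemma laplD A f g x : lapl A (fun y => f y + g y) x = lapl A f x + lapl A g x.
Proof.
rewrite /lapl -big_split; apply: eq_bigr => i _.
rewrite -big_split; apply: eq_bigr => j _.
by rewrite /Dtau /=; ring.
Qed.

Lemma laplZ A (c : R) f x : lapl A (fun y => c * f y) x = c * lapl A f x.
Proof.
rewrite /lapl mulr_sumr; apply: eq_bigr => i _.
by rewrite mulr_sumr; apply: eq_bigr => j _; rewrite /Dtau mulrBr.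
Qed.

Lemma lapl0 A x : lapl A (fun=> 0) x = 0.
Proof. by rewrite /lapl big1 // => i _; rewrite big1 // => j _; rewrite /Dtau subr0. Qed.

Lemma lapl_sum A (T : Type) (r : seq T) (F : T -> slice n k -> R) x :
  lapl A (fun y => \sum_(d <- r) F d y) x = \sum_(d <- r) lapl A (F d) x.
Proof.
elim: r => [|d r IHr].
  by rewrite big_nil -[RHS](lapl0 A x); congr lapl; apply: funext => y; rewrite big_nil.
rewrite big_cons -IHr -laplD; congr lapl; apply: funext => y.
by rewrite big_cons.
Qed.

(** Conjugation by a transposition of two elements of [A] permutes the transpositions of [A], so the
    Laplacian commutes with the switch. *)
Lemma lapl_Dtau A i j f x : i \in A -> j \in A ->
  lapl A (Dtau i j f) x = Dtau i j (lapl A f) x.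
Proof.
move=> iA jA.
have -> : Dtau i j f = fun y => f (switch i j y) + -1 * f y.
  by apply: funext => y; rewrite mulN1r.
by rewrite laplD laplZ lapl_switch // mulN1r.
Qed.

Lemma sum_mul_lapl A f g :
  \sum_(x : slice n k) f x * lapl A g x = - 2^-1 *
  \sum_(i in A) \sum_(j in A) \sum_(x : slice n k) Dtau i j f x * Dtau i j g x.
Proof.
under eq_bigr do rewrite /lapl mulr_sumr.
rewrite exchange_big mulr_sumr; apply: eq_bigr => i _.
under eq_bigr do rewrite mulr_sumr.
rewrite exchange_big mulr_sumr; apply: eq_bigr => j _.
exact: sum_mul_Dtau.
Qed.

Lemma sum_mul_laplC A f g :
  \sum_(x : slice n k) f x * lapl A g x = \sum_(x : slice n k) g x * lapl A f x.
Proof.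
rewrite !sum_mul_lapl; congr (_ * _); do 2!(apply: eq_bigr => ? _).
by apply: eq_bigr => x _; rewrite mulrC.
Qed.

Lemma eigen_orthogonal A f g (a b : R) : a != b ->
  (forall x, lapl A f x = a * f x) -> (forall x, lapl A g x = b * g x) ->
  \sum_(x : slice n k) f x * g x = 0.
Proof.
move=> ab fa gb; have := sum_mul_laplC A f g.
under eq_bigr do rewrite gb mulrCA.
under [in RHS]eq_bigr do rewrite fa mulrCA [g _ * _]mulrC.
rewrite -!mulr_sumr => /eqP; rewrite -subr_eq0 -mulrBl mulf_eq0 subr_eq0.
by rewrite eq_sym (negbTE ab) => /eqP.
Qed.

(* On two of the three coordinates i, j, l the point x takes the same value. *)
Lemma antisymmetric_switches i j l h x : l != i -> l != j -> i != j ->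
    (forall y, h (switch i j y) = - h y) ->
  h (switch i l x) + h (switch j l x) = h x.
Proof.
move=> li lj ij hN.
have h0 y : val y i = val y j -> h y = 0.
  move=> e; have := hN y; rewrite switch_same // => /eqP.
  by rewrite -addr_eq0 -mulr2n mulrn_eq0 => /eqP.
have tji : tperm j l i = i by rewrite tpermD // eq_sym // eq_sym.
have til : tperm i l j = j by rewrite tpermD // eq_sym // eq_sym.
have [e|ne] := eqVneq (val x i) (val x j).
  rewrite (h0 _ e); apply/eqP; rewrite addr_eq0 -hN; apply/eqP; congr h.
  apply: slice_inj => a; rewrite !switchE.
  case: (tpermP i j a) => [->|->|/eqP ai /eqP aj].
  - by rewrite tpermL tpermL.
  - by rewrite til tji.
  - case: (eqVneq a l) => [->|al]; first by rewrite !tpermR.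
    by rewrite !tpermD // eq_sym.
have [el|nel] := eqVneq (val x i) (val x l).
  by rewrite (switch_same el) (h0 (switch j l x)) ?addr0 // !switchE tji tpermL.
have {nel} el : val x j = val x l.
  by move: ne nel; do 3!case: (val x _).
by rewrite (switch_same el) (h0 (switch i l x)) ?add0r // !switchE til tpermL.
Qed.

(** For every other l in [A], the pairs {i, l} and {j, l} together contribute - h x, and {i, j}
    contributes - 2 h x. Counting ordered pairs doubles this: - 2 (|A| - 2) - 4 = - 2 |A|. *)
Lemma lapl_antisymmetric A i j h x : i \in A -> j \in A -> i != j ->
    (forall y, h (switch i j y) = - h y) ->
  lapl A h x = lapl (A :\ i :\ j) h x - 2 * #|A|%:R * h x.
Proof.
move=> iA jA ij hN.
have jA' : j \in A :\ i by rewrite !inE eq_sym ij.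
have split_sum (G : 'I_n -> R) :
    \sum_(a in A) G a = G i + (G j + \sum_(a in A :\ i :\ j) G a).
  by rewrite (big_setD1 i) //= (big_setD1 j).
have cA : #|A| = (2 + #|A :\ i :\ j|)%N.
  by rewrite (cardsD1 i) iA (cardsD1 j) jA'.
have sw1 l : l \in A :\ i :\ j -> Dtau i l h x + Dtau j l h x = - h x.
  rewrite !inE => /and3P[lj li _].
  have := antisymmetric_switches x li lj ij hN.
  by rewrite /Dtau => e; rewrite addrACA e; ring.
have D0 l : Dtau l l h x = 0 by rewrite /Dtau switch_same // subrr.
have DC a b : Dtau a b h x = Dtau b a h x by rewrite /Dtau switchC.
set S1 := \sum_(a in A :\ i :\ j) Dtau i a h x.
set S2 := \sum_(a in A :\ i :\ j) Dtau j a h x.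
have e : S1 + S2 = - #|A :\ i :\ j|%:R * h x.
  rewrite -big_split /= (eq_bigr _ sw1) sumr_const -mulr_natl; ring.
have eS : \sum_(a in A :\ i :\ j) \sum_(b in A) Dtau a b h x =
    S1 + (S2 + lapl (A :\ i :\ j) h x).
  rewrite /S1 /S2 /lapl -!big_split; apply: eq_bigr => a _ /=.
  by rewrite split_sum [Dtau i a h x]DC [Dtau j a h x]DC.
have Dij : Dtau i j h x = - 2 * h x by rewrite /Dtau hN; ring.
rewrite [LHS]split_sum eS !split_sum -/S1 -/S2 !D0 [Dtau j i h x]DC Dij.
rewrite cA natrD.
transitivity (lapl (A :\ i :\ j) h x + 2 * (S1 + S2) - 4 * h x); first by ring.
by rewrite e; ring.
Qed.

End Operators.

(** * Connectivity of the slice under switches *)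

Section Connectivity.
Context {n k : nat}.
Implicit Types (x y : slice n k) (i j : 'I_n) (A : {set 'I_n}).

Lemma slice_neq x y : x != y -> exists2 i, val x i & ~~ val y i.
Proof.
move=> xy; apply: contrapT => /forall2NP no.
have le_xy i : (val x i <= val y i)%N.
  by have [|] := no i; case: (val x i) (val y i) => [] [].
have sxy : (\sum_(i < n) val x i == \sum_(i < n) val y i)%N.
  by rewrite (eqP (valP x)) (eqP (valP y)).
move/negP: xy; apply; apply/eqP/slice_inj => i.
have [_] := leqif_sum (fun (i : 'I_n) (_ : true) => leqif_eq (le_xy i)).
rewrite sxy => /esym/forall_inP/(_ i isT)/eqP.
by case: (val x i) (val y i) => [] [].
Qed.

(** Induction on the number of coordinates where [x] and [y] differ. Both have k ones, so some
    coordinate is one in [x] only and another in [y] only; switching these two removes both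
    differences. *)
Lemma switch_connected (T : Type) (h : slice n k -> T) A x y :
    (forall i j z, i \in A -> j \in A -> h (switch i j z) = h z) ->
    (forall l, l \notin A -> val x l = val y l) ->
  h x = h y.
Proof.
move=> hA; have [m] := ubnP #|[set l | val x l != val y l]|.
elim: m => // m IHm in x *; rewrite ltnS => le_m xy.
have [->//|nxy] := eqVneq x y.
have [i xi yi] := slice_neq nxy.
have [j yj xj] : exists2 j, val y j & ~~ val x j by apply: slice_neq; rewrite eq_sym.
have iA : i \in A by apply: contraNT yi => /xy <-.
have jA : j \in A by apply: contraNT xj => /xy ->.
rewrite -(hA i j x) //; apply: IHm => [|l lA]; last first.
  rewrite switchE tpermD ?xy //; first by apply: contraNneq lA => <-.
  by apply: contraNneq lA => <-.
apply: leq_trans le_m; apply: proper_card; apply/properP; split.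
  apply/fintype.subsetP => l; rewrite !inE switchE.
  case: tpermP => [->|->|//]; last by rewrite xi yj.
  by rewrite (negbTE xj) (negbTE yi).
exists i; rewrite !inE ?switchE ?tpermL; first by rewrite xi (negbTE yi).
by rewrite (negbTE xj) (negbTE yi).
Qed.

End Connectivity.

(** * Annihilating polynomial and eigenspaces of the Laplacian *)

Section Spectrum.
Context {R : realType} {n k : nat}.
Implicit Types (x y : slice n k) (f g h : slice n k -> R) (i j : 'I_n).
Implicit Types (A : {set 'I_n}) (s : seq R).

Definition lapl_shift A (a : R) g : slice n k -> R :=
  fun x => lapl A g x + a * g x.

(** The polynomial in [lapl A] with roots - a, for a in [s], applied to [h]. The head of [s] is the
    outermost factor. *)
Definition lapl_poly A s h := foldr (lapl_shift A) h s.

Lemma lapl_poly_switch A s i j h x : i \in A -> j \in A ->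
  lapl_poly A s (fun y => h (switch i j y)) x = lapl_poly A s h (switch i j x).
Proof.
move=> iA jA; elim: s x => //= a s IHs x.
rewrite /lapl_shift IHs; congr (_ + _); rewrite -lapl_switch //.
by congr lapl; apply: funext.
Qed.

Lemma lapl_polyN A s h x : lapl_poly A s (fun y => - h y) x = - lapl_poly A s h x.
Proof.
elim: s x => //= a s IHs x; rewrite /lapl_shift IHs.
rewrite (_ : lapl_poly A s (fun y => - h y) = fun y => -1 * lapl_poly A s h y).
  by rewrite laplZ; ring.
by apply: funext => y; rewrite IHs mulN1r.
Qed.

Lemma lapl_poly_Dtau A s i j h x : i \in A -> j \in A ->
  lapl_poly A s (Dtau i j h) x = Dtau i j (lapl_poly A s h) x.
Proof.
move=> iA jA; elim: s x => //= a s IHs x.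
rewrite {1}/lapl_shift IHs (_ : lapl_poly A s _ = Dtau i j (lapl_poly A s h)).
  by rewrite lapl_Dtau // /Dtau /lapl_shift; ring.
by apply: funext => y; rewrite IHs.
Qed.

(** Each factor preserves antisymmetry in i and j, so [lapl_antisymmetric] applies to the factors
    one after the other and shifts every root. *)
Lemma lapl_poly_antisymmetric A s i j h x : i \in A -> j \in A -> i != j ->
    (forall y, h (switch i j y) = - h y) ->
  lapl_poly A s h x =
  lapl_poly (A :\ i :\ j) [seq a - 2 * #|A|%:R | a <- s] h x.
Proof.
move=> iA jA ij hN.
elim: s x => //= a s IHs x; rewrite /lapl_shift.
have anti y : lapl_poly A s h (switch i j y) = - lapl_poly A s h y.
  rewrite -lapl_poly_switch // -lapl_polyN; congr (lapl_poly A s _ y).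
  exact: funext.
rewrite (lapl_antisymmetric x iA jA ij anti) -IHs.
rewrite (_ : lapl_poly (A :\ i :\ j) _ h = lapl_poly A s h); first by ring.
by apply: funext => y; rewrite IHs.
Qed.

(* What remains true of [f] after [m] operators [Dtau] on disjoint pairs of
   coordinates, when [A] is the set of the untouched coordinates. *)
Definition reduced (m : nat) A h :=
  (#|A| + 2 * m = n)%N /\ forall x, h x != 0 -> (weight A x + m = k)%N.

Lemma reducedT f : reduced 0 setT f.
Proof. by split=> [|x _]; rewrite ?cardsT ?card_ord ?muln0 ?addn0 ?weightT. Qed.

Lemma weight_setD A i j x : i \in A -> j \in A -> i != j ->
  weight A x = (val x i + (val x j + weight (A :\ i :\ j) x))%N.
Proof.
move=> iA jA ij; rewrite /weight (big_setD1 i) //= (big_setD1 j) //.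
by rewrite !inE eq_sym ij.
Qed.

Lemma Dtau_antisymmetric i j h x :
  Dtau i j h (switch i j x) = - Dtau i j h x.
Proof. by rewrite /Dtau switchK opprB. Qed.

Lemma cardsD2 A i j : i \in A -> j \in A -> i != j ->
  #|A| = (#|A :\ i :\ j| + 2)%N.
Proof.
move=> iA jA ij; rewrite (cardsD1 i) iA (cardsD1 j) !inE eq_sym ij jA.
by rewrite addnA addnC.
Qed.

(** [Dtau i j h] vanishes where the coordinates i and j agree. On its support exactly one of them is
    1, so removing both lowers the weight by exactly one. *)
Lemma reduced_Dtau m A i j h : i \in A -> j \in A -> i != j ->
  reduced m A h -> reduced m.+1 (A :\ i :\ j) (Dtau i j h).
Proof.
move=> iA jA ij [cA wA]; split=> [|x hx].
  by move: cA; rewrite (cardsD2 iA jA ij); lia.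
have wAx : (weight A x + m)%N = k.
  have [h0|/wA//] := eqVneq (h x) 0.
  rewrite -(weight_switch x iA jA); apply: wA.
  by apply: contraNneq hx => h1; rewrite /Dtau h0 h1 subrr.
have : val x i != val x j.
  by apply: contraNneq hx => e; rewrite /Dtau switch_same // subrr.
move: wAx; rewrite (weight_setD x iA jA ij).
by case: (val x i) (val x j) => [] [] //=; lia.
Qed.

(** Once m reaches its maximum min(k, n - k), the weight left on the untouched coordinates is 0 or
    their full number, so any two of these coordinates agree. *)
Lemma extreme_weight (k' n' m a c w : nat) (b1 b2 : bool) : (k' <= n')%N ->
  m = minn k' (n' - k') -> a = (c + 2)%N -> (w <= c)%N -> (a + 2 * m)%N = n' ->
  (b1 + (b2 + w) + m)%N = k' -> b1 = b2.
Proof. by case: b1 b2 => [] [] //=; lia. Qed.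

(* Twice the eigenvalue of the sum of [- Dtau i j] over [i < j], on the harmonic
   homogeneous polynomials of degree [d] in [N] variables. *)
Definition nu (N d : nat) : R := 2 * d%:R * (N%:R + 1 - d%:R).

Lemma nuS N d : nu N.+2 d.+1 - 2 * N.+2%:R = nu N d.
Proof. by rewrite /nu -!natr1; ring. Qed.

Lemma nu0 N : nu N 0 = 0. Proof. by rewrite /nu mulr0 mul0r. Qed.

Lemma lapl_poly_nu r m A h : reduced m A h -> (k <= n)%N ->
  (m + r = minn k (n - k))%N ->
  forall x, lapl_poly A [seq nu #|A| d | d <- iota 0 r.+1] h x = 0.
Proof.
elim: r m A h => [|r IHr] m A h redA kn mr x.
  rewrite /= /lapl_shift nu0 mul0r addr0 /lapl big1 // => i iA.
  rewrite big1 // => j jA; rewrite /Dtau.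
  have [->|ij] := eqVneq i j; first by rewrite switch_same // subrr.
  have [cA wA] := redA.
  have same : (weight A x + m)%N = k -> switch i j x = x.
    rewrite (weight_setD x iA jA ij) => wx; apply: switch_same.
    apply: extreme_weight kn _ (cardsD2 iA jA ij) (weight_le _ _) cA wx.
    by rewrite -mr addn0.
  have [h0|/wA/same ->] := eqVneq (h x) 0; last by rewrite subrr.
  have [->|/wA] := eqVneq (h (switch i j x)) 0; first by rewrite h0 subrr.
  by rewrite weight_switch // => /same ->; rewrite subrr.
rewrite /= /lapl_shift nu0 mul0r addr0 /lapl big1 // => i iA.
rewrite big1 // => j jA.
have [->|ij] := eqVneq i j; first by rewrite /Dtau switch_same // subrr.
transitivity (lapl_poly A [seq nu #|A| d | d <- iota 1 r.+1] (Dtau i j h) x).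
  by rewrite lapl_poly_Dtau.
rewrite (lapl_poly_antisymmetric _ _ iA jA ij); last exact: Dtau_antisymmetric.
have := IHr _ _ _ (reduced_Dtau iA jA ij redA) kn _ x.
rewrite addSnnS => /(_ mr); congr (_ = 0).
congr (lapl_poly _ _ _ x).
rewrite -map_comp (iotaDl 1 0) -map_comp.
by apply: eq_map => d /=; rewrite (cardsD2 iA jA ij) addn2 nuS.
Qed.

(** Partial fractions. The induction hypothesis splits (lapl A + ev d) h into eigenfunctions [F e];
    dividing these by ev d - ev e and subtracting them from [h] leaves an element of the kernel of
    lapl A + ev d. *)
Lemma lapl_shift_eigen_sum A (ev : nat -> R) (ds : seq nat) h :
    uniq (map ev ds) -> (forall x, lapl_poly A (map ev ds) h x = 0) ->
  exists F : nat -> slice n k -> R,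
    (forall d x, d \in ds -> lapl A (F d) x = - ev d * F d x) /\
    (forall x, h x = \sum_(d <- ds) F d x).
Proof.
elim/last_ind: ds h => [|ds d IHds] h.
  by move=> _ h0; exists (fun _ _ => 0); split=> // x; rewrite big_nil -(h0 x).
rewrite map_rcons rcons_uniq => /andP[d_ds uds] h0.
have [x|F [Feig Fsum]] := IHds (lapl_shift A (ev d) h) uds.
  by rewrite -(h0 x) /lapl_poly foldr_rcons.
have nd e : e \in ds -> ev d - ev e != 0.
  by move=> eds; rewrite subr_eq0; apply: contraNneq d_ds => ->; apply: map_f.
have e_nd e : e \in ds -> e != d.
  by move=> eds; apply: contraTneq (nd _ eds) => ->; rewrite subrr eqxx.
pose G e : slice n k -> R := fun x => (ev d - ev e)^-1 * F e x.
exists (fun e => if e == d then fun x => h x - \sum_(e <- ds) G e x else G e).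
split=> [e x|x]; last first.
  rewrite -cats1 big_cat big_seq1 eqxx /=.
  rewrite (@eq_big_seq _ _ _ _ ds _ (G^~ x)) => [|e eds]; last first.
    by rewrite (negbTE (e_nd e eds)).
  by rewrite addrC subrK.
rewrite mem_rcons inE; have [->{e} _|ed /= eds] := eqVneq e d; last first.
  by rewrite laplZ Feig // /G; ring.
have -> : (fun x => h x - \sum_(e <- ds) G e x) =
    fun x => h x + (-1) * \sum_(e <- ds) G e x.
  by apply: funext => y; rewrite mulN1r.
rewrite laplD laplZ lapl_sum.
apply/eqP; rewrite -subr_eq0; apply/eqP.
transitivity (lapl_shift A (ev d) h x -
   (\sum_(e <- ds) lapl A (G e) x + ev d * \sum_(e <- ds) G e x)).
  by rewrite /lapl_shift; ring.
rewrite Fsum mulr_sumr -big_split /= -sumrB big_seq big1 // => e eds.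
rewrite laplZ Feig // /G; have := nd e eds; move: (ev d) (ev e) => a b ab.
by field.
Qed.

Lemma nu_inj : {in fun d => (2 * d <= n)%N &, injective (nu n)}.
Proof.
move=> d e; rewrite !unfold_in => dn en /eqP.
rewrite -subr_eq0 (_ : _ - _ = 2 * (d%:R - e%:R) * (n%:R + 1 - d%:R - e%:R)).
  rewrite /nu; set N : R := n%:R; rewrite !mulf_eq0 pnatr_eq0 /= => /orP[|/eqP].
    by rewrite subr_eq0 eqr_nat => /eqP.
  have : d%:R + e%:R <= n%:R :> R by rewrite -natrD ler_nat; lia.
  by move=> de e0; exfalso; move: de e0; rewrite -/N; lra.
by rewrite /nu; ring.
Qed.

Lemma eigen_decomposition f : (k <= n)%N ->
  exists F : nat -> slice n k -> R,
    (forall d x, (d <= minn k (n - k))%N ->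
       lapl setT (F d) x = - nu n d * F d x) /\
    (forall x, f x = \sum_(d < (minn k (n - k)).+1) F d x).
Proof.
move=> kn; set D := minn k (n - k).
have cT : #|finset.setT : {set 'I_n}| = n by rewrite cardsT card_ord.
have := lapl_poly_nu (reducedT f) kn (erefl : (0 + D)%N = D).
rewrite cT => h0.
have [|F [Feig Fsum]] := lapl_shift_eigen_sum _ h0.
  rewrite map_inj_in_uniq ?iota_uniq // => d e; rewrite !mem_iota => dD eD.
  by apply: nu_inj; rewrite unfold_in; move: dD eD; rewrite /D; lia.
exists F; split=> [d x dD|x]; first by apply: Feig; rewrite mem_iota.
by rewrite Fsum -[iota _ _]/(index_iota 0 D.+1) big_mkord.
Qed.

End Spectrum.

Lemma cauchy_schwarz_sum (R : realType) (T : Type) (r : seq T) (P : pred T)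
    (u v : T -> R) :
  (\sum_(i <- r | P i) u i * v i) ^+ 2 <=
  (\sum_(i <- r | P i) u i ^+ 2) * (\sum_(i <- r | P i) v i ^+ 2).
Proof.
elim: r => [|a r IHr]; first by rewrite !big_nil expr0n mul0r.
rewrite !big_cons; case: ifP => // _.
have : 0 <= \sum_(i <- r | P i) u i ^+ 2 by apply: sumr_ge0 => i _; exact: sqr_ge0.
have : 0 <= \sum_(i <- r | P i) v i ^+ 2 by apply: sumr_ge0 => i _; exact: sqr_ge0.
move: (\sum_(i <- r | P i) u i * v i) (\sum_(i <- r | P i) u i ^+ 2)
  (\sum_(i <- r | P i) v i ^+ 2) (u a) (v a) IHr => s U V x y sUV V0 U0.
suff : s * (x * y) * 2 <= U * y ^+ 2 + V * x ^+ 2 by nra.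
apply: le_trans (ler_norm _) _; rewrite -ler_sqr ?nnegrE ?normr_ge0 //; last first.
  by rewrite addr_ge0 // mulr_ge0 // sqr_ge0.
rewrite real_normK ?num_real //.
have : s ^+ 2 * (x * y) ^+ 2 <= U * V * (x * y) ^+ 2 by rewrite ler_wpM2r ?sqr_ge0.
have := sqr_ge0 (U * y ^+ 2 - V * x ^+ 2).
rewrite !exprMn; lra.
Qed.

(** * A Bonami-type inequality for eigenfunctions *)

Section OrbitCount.
Context {n k : nat}.
Implicit Types (x y : slice n k) (A B : {set 'I_n}).

(** Parametrizes the orbit of [x] under the switches inside [A] by the subsets of [A] with
    [weight A x] elements, so that the orbit can be counted. *)
Lemma slice_extension A x : exists phi : {set 'I_n} -> slice n k,
  forall B, B \subset A -> #|B| = weight A x ->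
  forall l, val (phi B) l = if l \in A then l \in B else val x l.
Proof.
(* The default value [x] of [insubd] is never taken when [B] is a subset of [A] of the right
   size. *)
pose phi B : slice n k := insubd x [ffun l => if l \in A then l \in B else val x l].
exists phi => B BA cB l; rewrite val_insubd ifT ?ffunE //.
have := valP x; rewrite (bigID (mem A)) [X in _ -> X == k](bigID (mem A)) /=.
congr (_ == k); congr (_ + _)%N; last first.
  by apply: eq_bigr => i iA; rewrite ffunE (negbTE iA).
rewrite -[LHS]cB -sum1_card.
under [RHS]eq_bigr => i iA do rewrite ffunE iA.
rewrite [LHS]big_mkcond [RHS]big_mkcond; apply: eq_bigr => i _.
by have := fintype.subsetP BA i; case: (i \in B) => [->//|_]; case: (i \in A).
Qed.

Lemma card_slice_le : (#|{: slice n k}| <= 'C(n, k))%N.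
Proof.
pose phi (x : slice n k) : {set 'I_n} := finset (val x).
have phi_inj : injective phi.
  by move=> x y /setP xy; apply: slice_inj => i; have := xy i; rewrite !inE.
rewrite -(card_imset _ phi_inj) -[n in 'C(n, k)]card_ord -card_draws.
apply/subset_leq_card/fintype.subsetP => _ /imsetP[x _ ->]; rewrite inE.
rewrite -[X in _ == X](eqP (valP x)) -sum1_card big_mkcond; apply/eqP.
by apply: eq_bigr => i _; rewrite inE; case: (val x i).
Qed.

Lemma card_slice_gt0 : (k <= n)%N -> (0 < #|{: slice n k}|)%N.
Proof.
move=> kn; apply/card_gt0P.
have e : (\sum_(i < n) [ffun i : 'I_n => (i < k)%N] i)%N == k.
  under eq_bigr do rewrite ffunE.
  rewrite -(big_mkord xpredT (fun i => nat_of_bool (i < k)%N)).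
  rewrite (@big_cat_nat _ _ _ k) //= big_nat.
  rewrite (eq_bigr (fun=> 1%N)); last by move=> i /andP[_ ->].
  rewrite -big_nat sum_nat_const_nat subn0 muln1 big_nat big1 ?addn0 //.
  by move=> i /andP[ki _]; rewrite ltnNge ki.
by exists (exist (fun x : {ffun 'I_n -> bool} => (\sum_(i < n) x i)%N == k) _ e).
Qed.

End OrbitCount.

(** * Fourth moments of eigenfunctions *)

Section Bonami.
Context {R : realType} {n k : nat}.
Implicit Types (x y : slice n k) (f g h : slice n k -> R) (i j : 'I_n).
Implicit Types (A : {set 'I_n}).

(** Pairing the equation with [h] gives a vanishing sum of squares of the differences
    [Dtau i j h]. *)
Lemma lapl_eq0_invariant A h : (forall x, lapl A h x = 0) ->
  forall i j x, i \in A -> j \in A -> h (switch i j x) = h x.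
Proof.
move=> h0 i j x iA jA; have := sum_mul_lapl A h h.
under eq_bigr do rewrite h0 mulr0.
rewrite big1 // => /esym/eqP; rewrite mulf_eq0 oppr_eq0 invr_eq0 pnatr_eq0 /=.
have D0 a b : 0 <= \sum_(x : slice n k) Dtau a b h x * Dtau a b h x.
  by apply: sumr_ge0 => y _; rewrite -expr2 sqr_ge0.
rewrite psumr_eq0 => [|a _]; last exact: sumr_ge0.
move=> /allP/(_ i); rewrite mem_index_enum iA => /(_ isT) /=.
rewrite psumr_eq0 // => /allP/(_ j); rewrite mem_index_enum jA => /(_ isT) /=.
rewrite psumr_eq0 => [|y _]; last by rewrite -expr2 sqr_ge0.
move=> /allP/(_ x); rewrite mem_index_enum => /(_ isT) /=.
by rewrite mulf_eq0 orbb subr_eq0 => /eqP.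
Qed.

(** The orbit of [x] has ['C(#|A|, weight A x)] points, and [h] takes the value [h x] on all of
    them. *)
Lemma invariant_sup_bound A h x :
    (forall i j y, i \in A -> j \in A -> h (switch i j y) = h y) ->
  'C(#|A|, weight A x)%:R * h x ^+ 2 <= \sum_(y : slice n k) h y ^+ 2.
Proof.
move=> hA; have [phi phiE] := slice_extension A x.
pose S := [set B : {set 'I_n} | B \subset A & #|B| == weight A x]%SET.
have phi_inj : {in S &, injective phi}.
  move=> B C; rewrite !inE => /andP[BA /eqP cB] /andP[CA /eqP cC] e.
  apply/setP => i; have := phiE B BA cB i; have := phiE C CA cC i.
  rewrite e => ->; case: ifP => [_ ->//|iA _].
  by rewrite (contraFF (fintype.subsetP BA i) iA) (contraFF (fintype.subsetP CA i) iA).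
rewrite -cards_draws -(card_in_imset phi_inj) mulr_natl -sumr_const.
rewrite [leRHS](bigID (mem (phi @: S)%SET)) /= -[leLHS]addr0 lerD //; last first.
  by apply: sumr_ge0 => y _; rewrite sqr_ge0.
apply: ler_sum => y /imsetP[B]; rewrite inE => /andP[BA /eqP cB] ->.
rewrite le_eqVlt (switch_connected (y := phi B) hA) ?eqxx // => l /negbTE lA.
by rewrite phiE // lA.
Qed.

(** Induction on d. For d = 0, [h] is constant on orbits of the switches in [A], so its square is at
    most its mean over an orbit. For d + 1, the induction hypothesis controls the fourth moments of
    the differences, and the equation paired with h^3 brings this back to [h] at the cost of a
    factor 9. *)
Lemma bonami_eigen d m A h : (k <= n)%N -> reduced m A h -> (m + d <= minn k (n - k))%N ->
    (forall x, lapl A h x = - nu #|A| d * h x) ->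
  \sum_(x : slice n k) h x ^+ 4 <=
  9 ^+ d / 'C(n - 2 * (m + d), k - (m + d))%:R * (\sum_(x : slice n k) h x ^+ 2) ^+ 2.
Proof.
move=> kn; elim: d m A h => [|d IHd] m A h redA mD heig.
  have inv i j x (iA : i \in A) (jA : j \in A) : h (switch i j x) = h x.
    by apply: lapl_eq0_invariant iA jA => y; rewrite heig nu0 oppr0 mul0r.
  move: mD redA => /[!addn0] mD [cA wA].
  rewrite expr0 mul1r expr2 mulrA [leRHS]mulr_sumr; apply: ler_sum => x _.
  rewrite (exprD _ 2 2) ler_wpM2r ?sqr_ge0 //.
  have [->|/wA wx] := eqVneq (h x) 0.
    rewrite expr0n /= mulr_ge0 ?invr_ge0 //.
    by apply: sumr_ge0 => y _; exact: sqr_ge0.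
  have := invariant_sup_bound x inv.
  have -> : #|A| = (n - 2 * m)%N by move: cA; set c := #|A|; lia.
  have -> : weight A x = (k - m)%N by move: wx; set c := weight A x; lia.
  rewrite mulrC -ler_pdivlMr 1?mulrC // ltr0n bin_gt0.
  by move: mD; rewrite leq_min => /andP[]; move: cA; set c := #|A|; lia.
have [cA wA] := redA.
set B : R := 9 ^+ d / 'C(n - 2 * (m + d.+1), k - (m + d.+1))%:R.
have B0 : 0 <= B by rewrite divr_ge0 // exprn_ge0.
set Z := \sum_x h x ^+ 4; set S := \sum_x h x ^+ 2.
have Z0 : 0 <= Z by apply: sumr_ge0 => x _; rewrite exprn_even_ge0.
have S0 : 0 <= S by apply: sumr_ge0 => x _; exact: sqr_ge0.
pose q i j := \sum_(x : slice n k) Dtau i j h x ^+ 2.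
have q0 i j : 0 <= q i j by apply: sumr_ge0 => x _; exact: sqr_ge0.
pose a i j := \sum_(x : slice n k) h x ^+ 2 * Dtau i j h x ^+ 2.
(* By [lapl_antisymmetric] and [nuS], [Dtau i j h] is an eigenfunction of degree d on the
   coordinates of [A] other than i and j. *)
have D4 i j : i \in A -> j \in A ->
    \sum_(x : slice n k) Dtau i j h x ^+ 4 <= B * q i j ^+ 2.
  move=> iA jA; have [->|ij] := eqVneq i j.
    rewrite big1 ?mulr_ge0 ?sqr_ge0 // => x _.
    by rewrite /Dtau switch_same // subrr expr0n.
  rewrite /B -addSnnS; apply: IHd; first exact: reduced_Dtau iA jA ij redA.
    by rewrite addSnnS.
  move=> x; have := lapl_antisymmetric x iA jA ij (@Dtau_antisymmetric _ _ _ i j h).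
  rewrite lapl_Dtau // => /eqP; rewrite eq_sym subr_eq => /eqP ->.
  have -> : nu #|A :\ i :\ j| d = nu #|A| d.+1 - 2 * #|A|%:R :> R.
    by rewrite (cardsD2 iA jA ij) addn2 nuS.
  by rewrite /Dtau !heig; ring.
have aq i j : i \in A -> j \in A -> a i j <= Num.sqrt (Z * B) * q i j.
  move=> iA jA; rewrite -ler_sqr ?nnegrE ?mulr_ge0 ?sqrtr_ge0 //; last first.
    by apply: sumr_ge0 => x _; rewrite mulr_ge0 ?sqr_ge0.
  rewrite exprMn sqr_sqrtr ?mulr_ge0 // -mulrA.
  apply: le_trans (cauchy_schwarz_sum _ _ _ _) _.
  under eq_bigr do rewrite -exprM.
  under [X in _ * X <= _]eq_bigr do rewrite -exprM.
  by rewrite ler_wpM2l // D4.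
have qsum : \sum_(i in A) \sum_(j in A) q i j = 2 * nu #|A| d.+1 * S.
  have := sum_mul_lapl A h h.
  under eq_bigr do rewrite heig mulrCA -expr2.
  rewrite -mulr_sumr -/S => e; apply: (@mulfI _ (- 2^-1)).
    by rewrite oppr_eq0 invr_eq0 pnatr_eq0.
  rewrite /q; under eq_bigr do under eq_bigr do under eq_bigr do rewrite expr2.
  by rewrite -e; field.
have nu_gt0 : 0 < nu #|A| d.+1 :> R.
  have : d.+1%:R <= #|A|%:R :> R.
    by rewrite ler_nat; move: cA mD; set c := #|A|; lia.
  by rewrite /nu => dA; rewrite mulr_gt0 // addrAC ltr_wpDl // subr_ge0.
(* Rests on (u^3 - v^3)(u - v) <= 3/2 (u - v)^2 (u^2 + v^2); the switch exchanges u and v, so both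
   halves of the right side have the same sum [a i j]. *)
have Zsum : nu #|A| d.+1 * Z <= 3 / 2 * \sum_(i in A) \sum_(j in A) a i j.
  have := sum_mul_lapl A (fun x => h x ^+ 3) h.
  under eq_bigr do rewrite heig mulrCA -exprSr.
  rewrite -mulr_sumr -/Z => e; apply: (@le_trans _ _ (- (- nu #|A| d.+1 * Z))).
    by rewrite mulNr opprK.
  rewrite e mulNr opprK !mulr_sumr; apply: ler_sum => i _.
  rewrite !mulr_sumr; apply: ler_sum => j _.
  have e2 : a i j = \sum_(x : slice n k) h (switch i j x) ^+ 2 * Dtau i j h x ^+ 2.
    rewrite /a -(sum_switch i j); apply: eq_bigr => x _.
    by rewrite Dtau_antisymmetric sqrrN.
  rewrite -[3](_ : 2 + 1 = _); last by ring.
  rewrite (_ : (2 + 1) / 2 * a i j = 2^-1 * (3 / 2 * (a i j + a i j))); last by field.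
  rewrite ler_wpM2l // [X in _ <= _ * (_ + X)]e2 -big_split mulr_sumr /=.
  apply: ler_sum => x _; rewrite /Dtau.
  move: (h (switch i j x)) (h x) => u v.
  have -> : (u ^+ 3 - v ^+ 3) * (u - v) = (u - v) ^+ 2 * (u ^+ 2 + u * v + v ^+ 2) by ring.
  rewrite -mulrDl mulrA mulrC ler_wpM2r ?sqr_ge0 //.
  by have := sqr_ge0 (u - v); nra.
(* The eigenvalue cancels between [Zsum] and [qsum], so the constant is uniform in it. Squaring and
   dividing by Z then gives Z <= 9 B S^2. *)
have Zr : Z <= 3 * Num.sqrt (Z * B) * S.
  rewrite -(ler_pM2l nu_gt0); apply: le_trans Zsum _.
  apply: (@le_trans _ _ (3 / 2 * (Num.sqrt (Z * B) * (2 * nu #|A| d.+1 * S)))).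
    rewrite ler_wpM2l // -qsum mulr_sumr; apply: ler_sum => i iA.
    by rewrite mulr_sumr; apply: ler_sum => j jA; apply: aq.
  by rewrite le_eqVlt; apply/orP; left; apply/eqP; field.
have [->|Znz] := eqVneq Z 0.
  by rewrite mulr_ge0 ?sqr_ge0 // divr_ge0 // exprn_ge0.
have Zgt0 : 0 < Z by rewrite lt_neqAle eq_sym Znz.
rewrite exprS -!mulrA [_ ^+ d * _]mulrA -/B -(ler_pM2l Zgt0).
have : Z ^+ 2 <= (3 * Num.sqrt (Z * B) * S) ^+ 2.
  by rewrite ler_sqr ?nnegrE // !mulr_ge0 ?sqrtr_ge0.
by rewrite !exprMn sqr_sqrtr ?mulr_ge0 //; lra.
Qed.

End Bonami.

(** * Ratio of the binomials (n choose k) and (n - 2d choose k - d) *)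

Section BinomialRatio.
Context {R : realType}.

(** This is (1 + 1/a)^d <= e for d <= a. It pays for the decrease of min(k, n - k) by one at each
    step of [bin_ratio]. *)
Lemma expn_succ_le (a d : nat) : (d <= a)%N ->
  a.+1%:R ^+ d <= expR 1 * a%:R ^+ d :> R.
Proof.
case: a => [|a] da.
  by move: da; rewrite leqn0 => /eqP ->; rewrite !expr0 mulr1 -expR0 ler_expR.
have a0 : (0 : R) < a.+1%:R by rewrite ltr0n.
have h : a.+2%:R <= a.+1%:R * expR (a.+1%:R^-1) :> R.
  rewrite -ler_pdivrMl // -[a.+2]addn1 natrD mulrDr mulVf ?gt_eqF // mulr1.
  exact: expR_ge1Dx.
apply: le_trans (lerXn2r d _ _ h) _; rewrite ?nnegrE ?mulr_ge0 ?expR_ge0 //.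
rewrite exprMn mulrC ler_wpM2r ?exprn_ge0 // -expRM_natl ler_expR.
by rewrite ler_pdivrMr // mul1r ler_nat.
Qed.

(** From k (n - k) (n choose k) = n (n - 1) (n - 2 choose k - 1), on dividing by max(k, n - k),
    which is at least n / 2. *)
Lemma bin_step (n k : nat) : (0 < k)%N -> (k < n)%N ->
  (minn k (n - k) * 'C(n, k) <= 2 * n * 'C(n - 2, k - 1))%N.
Proof.
case: k => // k _; case: n => // n; rewrite ltnS => kn.
case: n kn => // n; rewrite ltnS => kn.
have e1 := mul_bin_diag n.+2 k; have e2 := mul_bin_down n.+1 k.
rewrite /= in e1 e2; rewrite subn1 subn2 /=.
move: e1 e2; set c2 := 'C(n.+2, _); set c1 := 'C(n.+1, k); set c0 := 'C(n, k).
move=> e1 e2.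
set a := k.+1; set b := (n.+2 - a)%N.
have max_gt0 : (0 < maxn a b)%N by rewrite leq_max.
have e : (minn a b * maxn a b * c2 = n.+2 * n.+1 * c0)%N.
  have -> : (minn a b * maxn a b = a * b)%N.
    by rewrite /minn /maxn; case: ltnP => // _; rewrite mulnC.
  by rewrite mulnAC -e1 -mulnA [(c1 * b)%N]mulnC -[RHS]mulnA e2.
rewrite -(leq_pmul2r max_gt0) mulnAC e -!mulnA [(c0 * _)%N]mulnC !mulnA.
rewrite leq_mul2r [(2 * _)%N]mulnC -mulnA leq_mul2l.
by apply/orP; right; apply/orP; right; rewrite /b; lia.
Qed.

(** The bound [N] stays fixed while n decreases by two along the induction, so that all steps have
    the same factor 2 e N. *)
Lemma bin_ratio (d n k N : nat) : (n <= N)%N -> (k <= n)%N ->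
  (d <= minn k (n - k))%N ->
  'C(n, k)%:R * (minn k (n - k))%:R ^+ d <=
  (2 * expR 1 * N%:R) ^+ d * 'C(n - 2 * d, k - d)%:R :> R.
Proof.
elim: d n k => [|d IHd] n k nN kn dm; first by rewrite muln0 !subn0 mulr1 mul1r.
have k0 : (0 < k)%N by lia.
have k_lt_n : (k < n)%N by lia.
set m := minn k (n - k) in dm *.
have m' : minn (k - 1) (n - 2 - (k - 1)) = m.-1 by rewrite /m; lia.
have mS : m = m.-1.+1 by rewrite prednK //; lia.
have /IHd := leq_trans (leq_subr 2 n) nN => /(_ (k - 1)%N).
rewrite m' => /(_ ltac:(lia) ltac:(lia)) IH.
have -> : (n - 2 * d.+1 = n - 2 - 2 * d)%N by lia.
have -> : (k - d.+1 = k - 1 - d)%N by lia.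
have step : m%:R * 'C(n, k)%:R <= 2 * N%:R * 'C(n - 2, k - 1)%:R :> R.
  rewrite -!natrM ler_nat; apply: leq_trans (bin_step k0 k_lt_n) _.
  by rewrite leq_mul2r leq_mul2l nN !orbT.
rewrite exprS mulrA [_ * m%:R]mulrC.
apply: le_trans (ler_wpM2r _ step) _; first exact: exprn_ge0.
rewrite mS.
apply: le_trans (ler_wpM2l _ (expn_succ_le (d := d) (a := m.-1) _)) _.
- by rewrite !mulr_ge0.
- by lia.
rewrite (_ : _ * (_ * _) = 2 * expR 1 * N%:R * ('C(n - 2, k - 1)%:R * m.-1%:R ^+ d)).
  by rewrite exprS -[leRHS]mulrA ler_wpM2l // !mulr_ge0 ?expR_ge0.
by ring.
Qed.

End BinomialRatio.

(** * Exponential series of diagonalized operators *)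

Section ExpSeries.
Context {R : realType}.
Local Open Scope classical_set_scope.

Lemma cvg_series_expR_sum (D : nat) (t : R) (c G : 'I_D -> R) :
  series (fun m : nat => t ^+ m / m`!%:R * \sum_(d < D) c d ^+ m * G d) @ \oo
    --> \sum_(d < D) expR (t * c d) * G d.
Proof.
have -> : series (fun m : nat => t ^+ m / m`!%:R * \sum_(d < D) c d ^+ m * G d) =
    fun N => \sum_(d < D) series (exp_coeff (t * c d)) N * G d.
  apply: funext => N; rewrite /series /=; under [RHS]eq_bigr do rewrite mulr_suml.
  rewrite [RHS]exchange_big; apply: eq_bigr => m _.
  rewrite mulr_sumr; apply: eq_bigr => d _.
  by rewrite /exp_coeff /= exprMn; ring.
apply: cvg_big => [|d _]; first exact: add_continuous.
by apply: cvgMl; exact: is_cvg_series_exp_coeff.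
Qed.

Lemma series_exp_coeff_le (t : R) N : 0 <= t -> series (exp_coeff t) N <= expR t.
Proof.
move=> t0; apply: nondecreasing_cvgn_le; last exact: is_cvg_series_exp_coeff.
apply/nondecreasing_seqP => m; rewrite seriesSr /= lerDl.
by rewrite /exp_coeff /= divr_ge0 // exprn_ge0.
Qed.

End ExpSeries.

(** * Inequalities for finite sums *)

Section PowerSums.
Context {R : realType}.

Lemma sum_geometric_le (N : nat) : \sum_(d < N) (2^-1 ^+ d) ^+ 2 <= 2 :> R.
Proof.
suff : \sum_(d < N) (2^-1 ^+ d) ^+ 2 <= 2 - 2 * (2^-1 ^+ N) ^+ 2 :> R.
  by move/le_trans; apply; rewrite gerBl mulr_ge0 ?sqr_ge0.
elim: N => [|N IHN]; first by rewrite big_ord0 expr0; lra.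
rewrite big_ord_recr (exprS _ N) exprMn /=; have := sqr_ge0 ((2^-1 : R) ^+ N).
by move: IHN; move: (_ ^+ 2) (\sum_(d < N) _) => q S; lra.
Qed.

(** Cauchy-Schwarz with the weights 2^-d: the number of terms is traded for a factor 4^d, which the
    decay of the semigroup in the degree will absorb. *)
Lemma sum_sqr_le (N : nat) (a : nat -> R) :
  (\sum_(d < N) a d) ^+ 2 <= 2 * \sum_(d < N) 4 ^+ d * a d ^+ 2.
Proof.
have := cauchy_schwarz_sum (index_enum 'I_N) xpredT (fun d => 2^-1 ^+ d)
  (fun d => 2 ^+ d * a d).
rewrite (eq_bigr (fun d : 'I_N => a d)) => [|d _]; last by rewrite mulrA -exprMn mulVf // expr1n mul1r.
move=> /le_trans; apply; rewrite [in leRHS](eq_bigr (fun d : 'I_N => (2 ^+ d * a d) ^+ 2)).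
  apply: ler_wpM2r; last exact: sum_geometric_le.
  by apply: sumr_ge0 => d _; exact: sqr_ge0.
by move=> d _; rewrite exprMn -exprM mulnC exprM (_ : 2 ^+ 2 = 4) //; ring.
Qed.

Lemma sum_pow4_le (N : nat) (a : nat -> R) :
  (\sum_(d < N) a d) ^+ 4 <= 8 * \sum_(d < N) 64 ^+ d * a d ^+ 4.
Proof.
rewrite (exprM _ 2 2).
have S0 (b : nat -> R) : 0 <= \sum_(d < N) 4 ^+ d * b d ^+ 2.
  by apply: sumr_ge0 => d _; rewrite mulr_ge0 ?sqr_ge0 // exprn_ge0.
apply: (@le_trans _ _ ((2 * \sum_(d < N) 4 ^+ d * a d ^+ 2) ^+ 2)).
  by rewrite ler_sqr ?nnegrE ?sqr_ge0 ?mulr_ge0 // sum_sqr_le.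
rewrite exprMn; have := sum_sqr_le N (fun d => 4 ^+ d * a d ^+ 2).
rewrite [X in 2 * X](eq_bigr (fun d : 'I_N => 64 ^+ d * a d ^+ 4)); first lra.
move=> d _; rewrite (_ : 64 = 4 * (4 * 4)); last by ring.
by rewrite !exprMn; move: (4 ^+ d) (a d) => p q; ring.
Qed.

(** A Hoelder inequality by two uses of Cauchy-Schwarz: |v w| is split as |v|^(1/2) times |v|^(1/2)
    |w|, then |v| w^2 as |v| times w^2. *)
Lemma sum_mul_pow4_le (T : finType) (v w : T -> R) :
  (\sum_x v x * w x) ^+ 4 <=
  (\sum_x `|v x|) ^+ 2 * (\sum_x v x ^+ 2) * \sum_x w x ^+ 4.
Proof.
have := cauchy_schwarz_sum (index_enum T) xpredT (fun x => `|v x|) (fun x => w x ^+ 2).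
rewrite [X in _ <= X * _](eq_bigr (fun x => v x ^+ 2)) => [|x _]; last by rewrite real_normK ?num_real.
rewrite [X in _ <= _ * X](eq_bigr (fun x => w x ^+ 4)) => [h|x _]; last by rewrite -exprM.
have := cauchy_schwarz_sum (index_enum T) xpredT
  (fun x => Num.sqrt `|v x|) (fun x => Num.sqrt `|v x| * `|w x|).
rewrite [X in X ^+ _ <= _](eq_bigr (fun x => `|v x * w x|)) => [|x _]; last first.
  by rewrite mulrA -expr2 sqr_sqrtr // normrM.
rewrite [X in _ <= X * _](eq_bigr (fun x => `|v x|)) => [|x _]; last by rewrite sqr_sqrtr.
rewrite [X in _ <= _ * X](eq_bigr (fun x => `|v x| * w x ^+ 2)) => [h'|x _]; last first.
  by rewrite exprMn sqr_sqrtr // real_normK ?num_real.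
have vw : (\sum_x v x * w x) ^+ 2 <= (\sum_x `|v x * w x|) ^+ 2.
  rewrite -[leLHS]real_normK ?num_real // ler_sqr ?nnegrE ?sumr_ge0 //.
  exact: ler_norm_sum.
have := le_trans vw h'; rewrite -ler_sqr ?nnegrE ?sqr_ge0 //; last first.
  rewrite mulr_ge0 ?sumr_ge0 // => x _; by rewrite mulr_ge0 ?sqr_ge0.
rewrite -exprM exprMn => /le_trans; apply; rewrite -mulrA ler_wpM2l ?sqr_ge0 //.
Qed.

Lemma sum_pairs_sym (n : nat) (G : 'I_n -> 'I_n -> R) :
    (forall i j, G i j = G j i) -> (forall i, G i i = 0) ->
  \sum_(i < n) \sum_(j < n) G i j =
  2 * \sum_(i < n) \sum_(j < n | (i < j)%N) G i j.
Proof.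
move=> GC G0.
transitivity (\sum_(i < n) (\sum_(j < n | (i < j)%N) G i j +
   \sum_(j < n | (j < i)%N) G i j)).
  apply: eq_bigr => i _; rewrite (bigID (fun j : 'I_n => (i < j)%N)) /=.
  congr (_ + _); rewrite (bigD1 i) ?ltnn //= G0 add0r; apply: eq_bigl => j.
  by rewrite -leqNgt ltn_neqAle andbC.
rewrite big_split /= [X in _ + X](exchange_big_dep xpredT) //=.
rewrite [X in _ + X](eq_bigr (fun i : 'I_n => \sum_(j < n | (i < j)%N) G i j)).
  by ring.
by move=> i _; apply: eq_bigr => j _.
Qed.

End PowerSums.

(** * The heat semigroup *)

Section Heat.
Context {R : realType} {n k : nat}.
Hypotheses (k_gt0 : (0 < k)%N) (k_lt_n : (k < n)%N).
Implicit Types (x y : slice n k) (f g : slice n k -> R) (i j : 'I_n).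
Implicit Types (F : nat -> slice n k -> R) (s t : R) (d : nat).

Notation D := (minn k (n - k)).

(** The d-th eigenvalue of minus the generator. *)
Definition rate d : R := nu n d / (n%:R - 1).

Definition is_decomposition f F :=
  (forall d x, (d <= D)%N -> lapl setT (F d) x = - nu n d * F d x) /\
  (forall x, f x = \sum_(d < D.+1) F d x).

(** The semigroup written on eigencomponents; [semigroupE] identifies it with the power series. *)
Definition heat F t x : R := \sum_(d < D.+1) expR (- (rate d * t)) * F d x.

Definition level F d : R := \sum_(x : slice n k) F d x ^+ 2.

Let n1_gt0 : 0 < n%:R - 1 :> R.
Proof. by rewrite subr_gt0 ltr1n; lia. Qed.

Let n1_ge0 : 0 <= n%:R - 1 :> R. Proof. exact: ltW. Qed.

Lemma rate0 : rate 0 = 0. Proof. by rewrite /rate nu0 mul0r. Qed.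

(** Linear growth of the rates lets the decay at a fixed time beat any geometric loss K^d; at d >= 1
    it is also the Poincare inequality. *)
Lemma rate_ge d : (d <= D)%N -> d%:R <= rate d.
Proof.
move=> dD; rewrite /rate ler_pdivlMr // /nu [2 * _]mulrC -mulrA ler_wpM2l //.
have : (2 * d)%:R <= n%:R :> R by rewrite ler_nat; lia.
by rewrite natrM; lra.
Qed.

Lemma rate_ge0 d : (d <= D)%N -> 0 <= rate d.
Proof. by move/rate_ge; apply: le_trans. Qed.

Lemma level_ge0 F d : 0 <= level F d.
Proof. by apply: sumr_ge0 => x _; exact: sqr_ge0. Qed.

Lemma decompositionP f : exists F, is_decomposition f F.
Proof. exact: eigen_decomposition (ltnW k_lt_n). Qed.

Lemma heat0 f F : is_decomposition f F -> heat F 0 = f.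
Proof.
move=> [_ fE]; apply: funext => x; rewrite fE; apply: eq_bigr => d _.
by rewrite mulr0 oppr0 expR0 mul1r.
Qed.

Lemma heat_decomposition f F t : is_decomposition f F ->
  is_decomposition (heat F t) (fun d x => expR (- (rate d * t)) * F d x).
Proof. by move=> [Feig _]; split=> // d x dD; rewrite laplZ Feig //; ring. Qed.

Lemma heat_heat F s t x :
  heat (fun d x => expR (- (rate d * s)) * F d x) t x = heat F (s + t) x.
Proof.
apply: eq_bigr => d _; rewrite mulrA -expRD; congr (expR _ * _).
by ring.
Qed.

Lemma Dtau_decomposition f F i j : is_decomposition f F ->
  is_decomposition (Dtau i j f) (fun d => Dtau i j (F d)).
Proof.
move=> [Feig fE]; split=> [d x dD|x].
  by rewrite lapl_Dtau ?inE // /Dtau !Feig //; ring.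
by rewrite /Dtau !fE -sumrB.
Qed.

Lemma heat_Dtau F i j t x :
  heat (fun d => Dtau i j (F d)) t x = Dtau i j (heat F t) x.
Proof. by rewrite /heat /Dtau -sumrB; apply: eq_bigr => d _; rewrite mulrBr. Qed.

Lemma level_orthogonal f F d e : is_decomposition f F ->
  (d <= D)%N -> (e <= D)%N -> d != e -> \sum_(x : slice n k) F d x * F e x = 0.
Proof.
move=> [Feig _] dD eD de.
apply: (@eigen_orthogonal _ _ _ setT _ _ (- nu n d) (- nu n e)).
- rewrite eqr_opp; apply: contra_neq de => /nu_inj; apply; rewrite unfold_in; lia.
- by move=> x; rewrite Feig.
- by move=> x; rewrite Feig.
Qed.

Lemma level_dot f F (a b : nat -> R) : is_decomposition f F ->
  \sum_(x : slice n k)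
    (\sum_(d < D.+1) a d * F d x) * (\sum_(d < D.+1) b d * F d x) =
  \sum_(d < D.+1) a d * b d * level F d.
Proof.
move=> fF; under eq_bigr do rewrite mulr_suml.
rewrite exchange_big /=; apply: eq_bigr => d _.
under eq_bigr do rewrite mulr_sumr.
rewrite exchange_big /= (bigD1 d) //= [X in _ + X]big1 ?addr0 => [|e ed].
  by rewrite mulr_sumr; apply: eq_bigr => x _; rewrite mulrACA expr2.
under eq_bigr do rewrite mulrACA.
by rewrite -mulr_sumr (level_orthogonal fF) ?mulr0 1?eq_sym // -ltnS.
Qed.

Lemma heat_dot f F s t : is_decomposition f F ->
  \sum_(x : slice n k) heat F s x * heat F t x =
  \sum_(d < D.+1) expR (- (rate d * (s + t))) * level F d.
Proof.
move=> fF; rewrite (level_dot (fun d => expR (- (rate d * s)))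
  (fun d => expR (- (rate d * t))) fF).
by apply: eq_bigr => d _; rewrite mulrDr opprD expRD.
Qed.

Lemma heat_sqr f F t : is_decomposition f F ->
  \sum_(x : slice n k) heat F t x ^+ 2 =
  \sum_(d < D.+1) expR (- (rate d * (2 * t))) * level F d.
Proof.
move=> fF; under eq_bigr do rewrite expr2.
by rewrite (heat_dot _ _ fF); apply: eq_bigr => d _; congr (expR _ * _); ring.
Qed.

Lemma sum_sqr_level f F : is_decomposition f F ->
  \sum_(x : slice n k) f x ^+ 2 = \sum_(d < D.+1) level F d.
Proof.
move=> fF; rewrite -[in LHS](heat0 fF) (heat_sqr _ fF); apply: eq_bigr => d _.
by rewrite !mulr0 oppr0 expR0 mul1r.
Qed.

Lemma heat_energy f F t : is_decomposition f F ->
  \sum_(i < n) \sum_(j < n) \sum_(x : slice n k) Dtau i j (heat F t) x ^+ 2 =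
  2 * \sum_(d < D.+1) nu n d * (expR (- (rate d * (2 * t))) * level F d).
Proof.
move=> fF; have [Heig HE] := heat_decomposition t fF.
have := sum_mul_lapl setT (heat F t) (heat F t).
under [X in _ * X]eq_bigl do rewrite inE.
under [X in _ * X]eq_bigr do under eq_bigl do rewrite inE.
under [X in _ * X]eq_bigr do under eq_bigr do under eq_bigr do rewrite -expr2.
set S := \sum_(i < n) _ => e.
apply: (@mulfI _ (- 2^-1)); first by rewrite oppr_eq0 invr_eq0 pnatr_eq0.
rewrite -e mulrA mulNr mulVf ?pnatr_eq0 // mulN1r -sumrN.
pose a d := expR (- (rate d * t)) : R.
transitivity (\sum_(x : slice n k) heat F t x *
  \sum_(d < D.+1) - nu n d * a d * F d x).
  apply: eq_bigr => x _; congr (_ * _).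
  have -> : heat F t = fun x => \sum_(d < D.+1) a d * F d x by [].
  by rewrite lapl_sum; apply: eq_bigr => d _; rewrite Heig -1?ltnS // mulrA.
rewrite (level_dot a (fun d => - nu n d * a d) fF); apply: eq_bigr => d _.
rewrite (_ : - (rate d * (2 * t)) = - (rate d * t) + - (rate d * t)); last by ring.
by rewrite expRD /a; ring.
Qed.

Lemma generatorE f x : generator f x = (n%:R - 1)^-1 * lapl setT f x.
Proof.
rewrite /generator [2 / _]mulrC -mulrA; congr (_ * _).
rewrite -(sum_pairs_sym (G := fun i j => Dtau i j f x)) => [|i j|i].
- by apply: eq_big => [i|i _]; [rewrite inE | apply: eq_bigl => j; rewrite inE].
- by rewrite /Dtau switchC.
- by rewrite /Dtau switch_same // subrr.
Qed.

Lemma iter_eigen f F (L : (slice n k -> R) -> slice n k -> R) (c : nat -> R) m x :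
    is_decomposition f F ->
    (forall (a : nat -> R) y, L (fun y => \sum_(d < D.+1) a d * F d y) y =
       \sum_(d < D.+1) a d * c d * F d y) ->
  iter m L f x = \sum_(d < D.+1) c d ^+ m * F d x.
Proof.
move=> [_ fE] Llin; elim: m x => [|m IHm] x.
  by rewrite /= fE; apply: eq_bigr => d _; rewrite expr0 mul1r.
rewrite iterS (_ : iter m L f = fun y => \sum_(d < D.+1) c d ^+ m * F d y).
  by rewrite (Llin (fun d => c d ^+ m)); apply: eq_bigr => d _; rewrite exprSr.
exact: funext.
Qed.

Lemma lapl_comb f F (a : nat -> R) x : is_decomposition f F ->
  lapl setT (fun y => \sum_(d < D.+1) a d * F d y) x =
  \sum_(d < D.+1) a d * - nu n d * F d x.
Proof.
move=> [Feig _]; rewrite lapl_sum; apply: eq_bigr => d _.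
by rewrite laplZ Feig -1?ltnS // mulrA.
Qed.

(** * Contraction in L^1, smoothing from L^2 to L^4 *)

Definition all_switches f x : R := \sum_(i < n) \sum_(j < n) f (switch i j x).

Lemma all_switchesE f x : all_switches f x = lapl setT f x + n%:R ^+ 2 * f x.
Proof.
rewrite /all_switches.
transitivity (\sum_(i < n) \sum_(j < n) (Dtau i j f x + f x)).
  by apply: eq_bigr => i _; apply: eq_bigr => j _; rewrite subrK.
under eq_bigr do rewrite big_split /=.
rewrite big_split /=; congr (_ + _).
  by apply: eq_big => [i|i _]; [rewrite inE | apply: eq_bigl => j; rewrite inE].
by rewrite !sumr_const !card_ord -mulrnA -[LHS]mulr_natl natrM expr2.
Qed.

Lemma sum_norm_all_switches f :
  \sum_(x : slice n k) `|all_switches f x| <=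
  n%:R ^+ 2 * \sum_(x : slice n k) `|f x|.
Proof.
apply: (@le_trans _ _ (\sum_(x : slice n k) \sum_(i < n) \sum_(j < n) `|f (switch i j x)|)).
  apply: ler_sum => x _; apply: le_trans (ler_norm_sum _ _ _) _.
  by apply: ler_sum => i _; exact: ler_norm_sum.
rewrite exchange_big /=; under eq_bigr do rewrite exchange_big /=.
under eq_bigr do under eq_bigr do rewrite (sum_switch _ _ (fun x => `|f x|)).
by rewrite !sumr_const !card_ord -mulrnA -[leLHS]mulr_natl natrM expr2.
Qed.

(* The operator [all_switches] is positive, and it differs from a multiple of
   the generator by a multiple of the identity. *)
Lemma heat_norm1 f F t : is_decomposition f F -> 0 <= t ->
  \sum_(x : slice n k) `|heat F t x| <= \sum_(x : slice n k) `|f x|.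
Proof.
move=> fF t0; set r : R := t / (n%:R - 1); set q : R := n%:R ^+ 2.
have r0 : 0 <= r by rewrite divr_ge0 // ltW.
have q0 : 0 <= q by exact: sqr_ge0.
have iterE m x : iter m all_switches f x = \sum_(d < D.+1) (q - nu n d) ^+ m * F d x.
  apply: (@iter_eigen f F _ (fun d => q - nu n d)) => // a y; rewrite all_switchesE (lapl_comb _ _ fF) mulr_sumr.
  by rewrite -big_split; apply: eq_bigr => d _ /=; rewrite /q; ring.
have norm_iter m : \sum_(x : slice n k) `|iter m all_switches f x| <=
    q ^+ m * \sum_(x : slice n k) `|f x|.
  elim: m => [|m IHm]; first by rewrite mul1r.
  rewrite iterS; apply: le_trans (sum_norm_all_switches _) _.
  by rewrite -/q (exprS q) -mulrA ler_wpM2l.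
(* Partial sums of the exponential of r [all_switches], which tend to e^(r q) times [heat F t].
   Their L^1 norms are at most the partial sums of e^(r q) times that of [f]. *)
pose u (x : slice n k) : nat -> R :=
  series (fun m => r ^+ m / m`!%:R * iter m all_switches f x).
have u_cvg x : (u x @ \oo --> expR (r * q) * heat F t x)%classic.
  have := @cvg_series_expR_sum R D.+1 r (fun d : 'I_D.+1 => q - nu n d) (fun d : 'I_D.+1 => F d x).
  rewrite (_ : \sum_(d < D.+1) _ = expR (r * q) * heat F t x).
    move=> h; rewrite (_ : u x = series (fun m : nat =>
      r ^+ m / m`!%:R * \sum_(d < D.+1) (q - nu n d) ^+ m * F d x)) //.
    by apply: funext => N; apply: eq_bigr => m _; rewrite iterE.
  rewrite /heat mulr_sumr; apply: eq_bigr => d _.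
  by rewrite mulrA -expRD; congr (expR _ * _); rewrite /rate /r; field; rewrite gt_eqF.
have norm_cvg : (\sum_(x : slice n k) `|u x N| @[N --> \oo] -->
    \sum_(x : slice n k) `|expR (r * q) * heat F t x|)%classic.
  by apply: cvg_big => [|x _]; [exact: add_continuous | exact: cvg_norm].
rewrite -(ler_pM2l (expR_gt0 (r * q))) mulr_sumr.
rewrite (eq_bigr (fun x => `|expR (r * q) * heat F t x|)); last first.
  by move=> x _; rewrite normrM ger0_norm ?expR_ge0.
rewrite -(cvg_lim _ norm_cvg) //; apply: limr_le.
  by apply/cvg_ex; eexists; exact: norm_cvg.
apply: nearW => N.
apply: (@le_trans _ _ (series (exp_coeff (r * q)) N * \sum_(x : slice n k) `|f x|)).
  apply: (@le_trans _ _ (\sum_(x : slice n k)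
      \sum_(0 <= m < N) r ^+ m / m`!%:R * `|iter m all_switches f x|)).
    apply: ler_sum => x _; rewrite /u /series /=; apply: le_trans (ler_norm_sum _ _ _) _.
    apply: ler_sum => m _; rewrite normrM ger0_norm //.
    by rewrite divr_ge0 // exprn_ge0.
  rewrite exchange_big /= /series /= mulr_suml; apply: ler_sum => m _.
  rewrite -mulr_sumr /exp_coeff /=.
  rewrite [leRHS](_ : _ = r ^+ m / m`!%:R * (q ^+ m * \sum_x `|f x|)); last first.
    by rewrite (exprMn _ r q); move: (r ^+ m) (q ^+ m) (_^-1) (\sum_x _) => a b c S; ring.
  by rewrite ler_wpM2l // divr_ge0 // exprn_ge0.
by rewrite ler_wpM2r ?sumr_ge0 // series_exp_coeff_le // mulr_ge0.
Qed.

(** Splitting into levels costs 64^d, and the fourth moment of level d, normalized by the size of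
    the slice, costs K^d by [bonami_eigen]. The decay e^(- 4 d s) compensates for (64 K)^d. *)
Lemma heat_pow4 f F (K s : R) : is_decomposition f F -> 0 <= K -> 0 <= s ->
    64 * K <= expR (4 * s) ->
    (forall d, (d <= D)%N ->
       9 ^+ d * 'C(n, k)%:R <= K ^+ d * 'C(n - 2 * d, k - d)%:R) ->
  #|{: slice n k}|%:R * \sum_(x : slice n k) heat F s x ^+ 4 <=
  8 * (\sum_(x : slice n k) f x ^+ 2) ^+ 2.
Proof.
move=> fF K0 s0 Ks HK; have [Feig _] := fF; set M := #|_|%:R.
have step1 : \sum_(x : slice n k) heat F s x ^+ 4 <= 8 * \sum_(d < D.+1)
    64 ^+ d * expR (- (rate d * s)) ^+ 4 * \sum_(x : slice n k) F d x ^+ 4.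
  apply: (@le_trans _ _ (\sum_(x : slice n k) 8 * \sum_(d < D.+1)
      64 ^+ d * (expR (- (rate d * s)) * F d x) ^+ 4)).
    by apply: ler_sum => x _; apply: (sum_pow4_le D.+1 (fun d => expR (- (rate d * s)) * F d x)).
  rewrite -mulr_sumr exchange_big ler_wpM2l //=; apply: ler_sum => d _.
  rewrite mulr_sumr; apply: ler_sum => x _.
  by rewrite exprMn mulrA.
apply: le_trans (ler_wpM2l _ step1) _ => //; rewrite mulrCA ler_wpM2l //.
rewrite (sum_sqr_level fF) mulr_sumr.
apply: (@le_trans _ _ (\sum_(d < D.+1) level F d ^+ 2)); last first.
  rewrite expr2 mulr_suml; apply: ler_sum => d _; rewrite expr2 ler_wpM2l ?level_ge0 //.
  by rewrite (bigD1 d) //= lerDl sumr_ge0 // => e _; exact: level_ge0.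
apply: ler_sum => d _; have dD : (d <= D)%N by rewrite -ltnS.
have C_gt0 : (0 : R) < 'C(n - 2 * d, k - d)%:R by rewrite ltr0n bin_gt0; lia.
have F4 : \sum_(x : slice n k) F d x ^+ 4 <=
    9 ^+ d / 'C(n - 2 * d, k - d)%:R * level F d ^+ 2.
  apply: (bonami_eigen (m := 0) (ltnW k_lt_n) (reducedT _)) => // x.
  by rewrite Feig // cardsT card_ord.
have MC : M * (9 ^+ d / 'C(n - 2 * d, k - d)%:R) <= K ^+ d.
  rewrite mulrA ler_pdivrMr // mulrC; apply: le_trans (HK d dD).
  by rewrite ler_wpM2l ?exprn_ge0 // ler_nat card_slice_le.
have KE : 64 ^+ d * K ^+ d * expR (- (rate d * s)) ^+ 4 <= 1.
  rewrite -exprMn -[expR _ ^+ 4]expRM_natl mulrN expRN -[_ / _]/(_ / _).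
  rewrite ler_pdivrMr ?expR_gt0 // mul1r.
  apply: (@le_trans _ _ (expR (4 * s) ^+ d)); first by rewrite lerXn2r // nnegrE ?expR_ge0 // mulr_ge0.
  rewrite -expRM_natl ler_expR mulrCA ler_wpM2l // ler_wpM2r // rate_ge //.
apply: (@le_trans _ _ (64 ^+ d * expR (- (rate d * s)) ^+ 4 * (K ^+ d * level F d ^+ 2))).
  rewrite mulrCA ler_wpM2l ?mulr_ge0 ?exprn_ge0 ?expR_ge0 //.
  apply: le_trans (ler_wpM2l _ F4) _ => //.
  by rewrite mulrA ler_wpM2r ?sqr_ge0.
by rewrite mulrA -[leRHS]mul1r ler_wpM2r ?sqr_ge0 // mulrAC.
Qed.

(** The squared L^2 norm of P_(2s) f is the inner product of P_s f and P_(3s) f. In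
    [sum_mul_pow4_le], the L^4 norm of P_(3s) f = P_s (P_(2s) f) is bounded by the L^2 norm of
    P_(2s) f, so two of the four factors phi cancel. *)
Lemma heat_smoothing f F (K s : R) : is_decomposition f F -> 0 <= K -> 0 <= s ->
    64 * K <= expR (4 * s) ->
    (forall d, (d <= D)%N ->
       9 ^+ d * 'C(n, k)%:R <= K ^+ d * 'C(n - 2 * d, k - d)%:R) ->
  #|{: slice n k}|%:R * (\sum_(x : slice n k) heat F (2 * s) x ^+ 2) ^+ 2 <=
  8 * (\sum_(x : slice n k) `|f x|) ^+ 2 * \sum_(x : slice n k) heat F s x ^+ 2.
Proof.
move=> fF K0 s0 Ks HK; set phi := \sum_(x : slice n k) heat F (2 * s) x ^+ 2.
set psi := \sum_(x : slice n k) heat F s x ^+ 2; set M := #|_|%:R.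
have phi0 : 0 <= phi by apply: sumr_ge0 => x _; exact: sqr_ge0.
have psi0 : 0 <= psi by apply: sumr_ge0 => x _; exact: sqr_ge0.
have phiE : phi = \sum_(x : slice n k) heat F s x * heat F (2 * s + s) x.
  rewrite /phi (heat_sqr _ fF) (heat_dot _ _ fF); apply: eq_bigr => d _.
  by congr (expR _ * _); ring.
have := heat_pow4 (heat_decomposition (2 * s) fF) K0 s0 Ks HK.
rewrite (eq_bigr (fun x => heat F (2 * s + s) x ^+ 4)) => [|x _]; last by rewrite heat_heat.
rewrite -/phi -/M => h4.
have [->|nz] := eqVneq phi 0; first by rewrite expr0n /= mulr0 mulr_ge0 // mulr_ge0 // sqr_ge0.
have phi_gt0 : 0 < phi by rewrite lt_neqAle eq_sym nz.
have := sum_mul_pow4_le (heat F s) (heat F (2 * s + s)); rewrite -phiE -/psi.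
move=> /(ler_wpM2l (ler0n R #|{: slice n k}|)); rewrite -/M [leRHS]mulrCA => h.
have M0 : 0 <= M by rewrite ler0n.
have N1 := heat_norm1 fF s0.
have N2 : (\sum_(x : slice n k) `|heat F s x|) ^+ 2 <= (\sum_(x : slice n k) `|f x|) ^+ 2.
  by rewrite ler_sqr ?nnegrE ?sumr_ge0.
rewrite -(ler_pM2r (exprn_gt0 2 phi_gt0)).
rewrite (_ : M * phi ^+ 2 * phi ^+ 2 = M * phi ^+ 4); last by ring.
apply: (le_trans h); apply: (@le_trans _ _
  ((\sum_(x : slice n k) `|f x|) ^+ 2 * psi * (8 * phi ^+ 2))).
  apply: ler_pM => //; last by rewrite ler_wpM2r.
    by rewrite mulr_ge0 ?sqr_ge0.
  by rewrite mulr_ge0 // sumr_ge0 // => x _; rewrite exprn_even_ge0.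
by rewrite le_eqVlt; apply/orP; left; apply/eqP; ring.
Qed.

(** The nonconstant levels only, hence the index shift. By [variance_heat], its value at 2 t is the
    variance of P_t f times the size of the slice. *)
Definition tail F t : R := \sum_(d < D) expR (- (rate d.+1 * t)) * level F d.+1.

Lemma tail_ge0 F t : 0 <= tail F t.
Proof. by apply: sumr_ge0 => d _; rewrite mulr_ge0 ?expR_ge0 ?level_ge0. Qed.

Lemma tail_homo F s t : s <= t -> tail F t <= tail F s.
Proof.
move=> st; apply: ler_sum => d _; rewrite ler_wpM2r ?level_ge0 // ler_expR lerN2.
by rewrite ler_wpM2l // rate_ge0.
Qed.

Lemma tail_le f F t : is_decomposition f F -> 0 <= t ->
  tail F t <= \sum_(x : slice n k) f x ^+ 2.
Proof.
move=> fF t0; rewrite (sum_sqr_level fF) big_ord_recl -[leLHS]add0r lerD ?level_ge0 //.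
apply: ler_sum => d _; rewrite -[leRHS]mul1r ler_wpM2r ?level_ge0 // -expR0 ler_expR.
by rewrite oppr_le0 mulr_ge0 // rate_ge0.
Qed.

(** [heat_smoothing] applied to every [Dtau i j f], summed over pairs with Cauchy-Schwarz. The
    energy of P_(2s) f bounds the tail because nonzero rates are at least 1, and the energy of P_s f
    is bounded by the L^2 norm of [f]. *)
Lemma tail_influence f F (K s : R) : is_decomposition f F -> 0 <= K -> 1 / 2 <= s ->
    64 * K <= expR (4 * s) ->
    (forall d, (d <= D)%N ->
       9 ^+ d * 'C(n, k)%:R <= K ^+ d * 'C(n - 2 * d, k - d)%:R) ->
  #|{: slice n k}|%:R * (n%:R - 1) * tail F (4 * s) ^+ 2 <=
  4 * (\sum_(i < n) \sum_(j < n) (\sum_(x : slice n k) `|Dtau i j f x|) ^+ 2) *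
  \sum_(x : slice n k) f x ^+ 2.
Proof.
move=> fF K0 s12 Ks HK; have s0 : 0 <= s by apply: le_trans s12; lra.
set M := #|_|%:R; set N2 := \sum_(i < n) \sum_(j < n) _.
pose N i j := \sum_(x : slice n k) `|Dtau i j f x|.
pose phi i j := \sum_(x : slice n k) Dtau i j (heat F (2 * s)) x ^+ 2.
pose psi i j := \sum_(x : slice n k) Dtau i j (heat F s) x ^+ 2.
have M_gt0 : 0 < M by rewrite ltr0n card_slice_gt0 // ltnW.
have psi0 i j : 0 <= psi i j by apply: sumr_ge0 => x _; exact: sqr_ge0.
have phi0 i j : 0 <= phi i j by apply: sumr_ge0 => x _; exact: sqr_ge0.
have N0 i j : 0 <= N i j by apply: sumr_ge0.
have phi_le i j : Num.sqrt M * phi i j <= Num.sqrt 8 * N i j * Num.sqrt (psi i j).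
  rewrite -ler_sqr ?nnegrE ?mulr_ge0 ?sqrtr_ge0 // !exprMn !sqr_sqrtr //.
  have := heat_smoothing (Dtau_decomposition i j fF) K0 s0 Ks HK.
  rewrite [X in _ * X ^+ 2 <= _](eq_bigr (fun x => Dtau i j (heat F (2 * s)) x ^+ 2)) => [|x _]; last by rewrite heat_Dtau.
  rewrite [X in _ <= _ * X](eq_bigr (fun x => Dtau i j (heat F s) x ^+ 2)) => [//|x _].
  by rewrite heat_Dtau.
have phi_sum : 2 * (n%:R - 1) * tail F (4 * s) <= \sum_(i < n) \sum_(j < n) phi i j.
  rewrite (heat_energy _ fF) -mulrA ler_wpM2l // big_ord_recl nu0 mul0r add0r.
  rewrite /tail mulr_sumr; apply: ler_sum => d _.
  rewrite (_ : 2 * (2 * s) = 4 * s); last by ring.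
  rewrite ler_wpM2r ?mulr_ge0 ?expR_ge0 ?level_ge0 //.
  have := @rate_ge d.+1 (ltn_ord d); rewrite /rate ler_pdivlMr //.
  by apply: le_trans; rewrite ler_peMl ?ler1n // ltW.
have psi_sum : \sum_(i < n) \sum_(j < n) psi i j <=
    2 * (n%:R - 1) * \sum_(x : slice n k) f x ^+ 2.
  rewrite (heat_energy _ fF) -mulrA ler_wpM2l // (sum_sqr_level fF) mulr_sumr.
  apply: ler_sum => d _; rewrite mulrA ler_wpM2r ?level_ge0 //.
  have dD : (d <= D)%N by rewrite -ltnS.
  have -> : nu n d = (n%:R - 1) * rate d by rewrite /rate; field; rewrite gt_eqF.
  (* A rate z satisfies z <= 1 + 2 s z <= e^(2 s z) because s >= 1/2. *)
  rewrite -mulrA -[leRHS]mulr1 ler_wpM2l // expRN ler_pdivrMr ?expR_gt0 // mul1r.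
  have := expR_ge1Dx (rate d * (2 * s)); have := rate_ge0 dD; nra.
have h : Num.sqrt M * (\sum_(i < n) \sum_(j < n) phi i j) <=
    Num.sqrt 8 * \sum_(i < n) \sum_(j < n) N i j * Num.sqrt (psi i j).
  rewrite !mulr_sumr; apply: ler_sum => i _; rewrite !mulr_sumr.
  by apply: ler_sum => j _; rewrite mulrA.
have cs : (\sum_(i < n) \sum_(j < n) N i j * Num.sqrt (psi i j)) ^+ 2 <=
    N2 * \sum_(i < n) \sum_(j < n) psi i j.
  rewrite /N2 (pair_big xpredT xpredT (fun i j => N i j * Num.sqrt (psi i j))).
  rewrite (pair_big xpredT xpredT (fun i j => N i j ^+ 2)).
  rewrite (pair_big xpredT xpredT psi) /=.
  apply: le_trans (cauchy_schwarz_sum _ _ (fun p => N p.1 p.2) (fun p => Num.sqrt (psi p.1 p.2))) _.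
  by rewrite [X in _ * X <= _](eq_bigr (fun p => psi p.1 p.2)) // => p _; rewrite sqr_sqrtr.
have : (Num.sqrt M * (2 * (n%:R - 1) * tail F (4 * s))) ^+ 2 <=
    (Num.sqrt 8 * \sum_(i < n) \sum_(j < n) N i j * Num.sqrt (psi i j)) ^+ 2.
  rewrite ler_sqr ?nnegrE.
  - by apply: le_trans h; rewrite ler_wpM2l ?sqrtr_ge0.
  - by rewrite !mulr_ge0 ?sqrtr_ge0 ?tail_ge0 ?ltW.
  - rewrite mulr_ge0 ?sqrtr_ge0 // sumr_ge0 // => i _; rewrite sumr_ge0 // => j _.
    by rewrite mulr_ge0 ?sqrtr_ge0.
rewrite !exprMn !sqr_sqrtr // => h2.
have N20 : 0 <= N2.
  by apply: sumr_ge0 => i _; apply: sumr_ge0 => j _; exact: sqr_ge0.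
have h3 := le_trans h2 (ler_wpM2l (ler0n R 8) (le_trans cs (ler_wpM2l N20 psi_sum))).
rewrite -(ler_pM2l (mulr_gt0 (ltr0n R 4) n1_gt0)); move: h3.
by congr (_ <= _); ring.
Qed.

(** * Variance, Dirichlet form and norms on the levels *)

Lemma level0_const f F x y : is_decomposition f F -> F 0 x = F 0 y.
Proof.
move=> [Feig _]; apply: (switch_connected (A := setT)) => [i j z _ _|l].
  apply: (@lapl_eq0_invariant R n k setT); rewrite ?inE // => w.
  by rewrite Feig // nu0 oppr0 mul0r.
by rewrite inE.
Qed.

Lemma sum_level_eq0 f F d : is_decomposition f F -> (0 < d <= D)%N ->
  \sum_(x : slice n k) F d x = 0.
Proof.
move=> [Feig _] /andP[d0 dD]; under eq_bigr do rewrite -[F d _]mulr1.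
apply: (@eigen_orthogonal _ _ _ setT (F d) (fun=> 1) (- nu n d) 0) => [|x|x].
- rewrite oppr_eq0 gt_eqF //; have := rate_ge dD.
  by rewrite /rate ler_pdivlMr //; apply: lt_le_trans; rewrite mulr_gt0 ?ltr0n.
- by rewrite Feig.
- rewrite mul0r /lapl big1 // => i _; rewrite big1 // => j _.
  by rewrite /Dtau subrr.
Qed.

Lemma semigroupE f F t : is_decomposition f F -> semigroup t f = heat F t.
Proof.
move=> fF; apply: funext => x; rewrite /semigroup; apply: cvg_lim => //.
have := @cvg_series_expR_sum R D.+1 t (fun d : 'I_D.+1 => - rate d) (fun d : 'I_D.+1 => F d x).
rewrite (_ : \sum_(d < D.+1) _ = heat F t x); last first.
  by apply: eq_bigr => d _; congr (expR _ * _); rewrite mulrN mulrC.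
move=> h; rewrite (_ : series _ = series (fun m : nat =>
  t ^+ m / m`!%:R * \sum_(d < D.+1) (- rate d) ^+ m * F d x)) //.
apply: funext => N; apply: eq_bigr => m _; congr (_ * _). apply: (@iter_eigen f F _ (fun d => - rate d)) => // a y.
rewrite generatorE (lapl_comb _ _ fF) mulr_sumr; apply: eq_bigr => d _.
by rewrite /rate; field; rewrite gt_eqF.
Qed.

Lemma variance_heat f F t : is_decomposition f F ->
  Defs.variance (heat F t) = tail F (2 * t) / #|{: slice n k}|%:R.
Proof.
move=> fF; rewrite /Defs.variance /mean (heat_sqr _ fF) big_ord_recl /= -/(tail F (2 * t)).
set M := #|_|%:R; have M_gt0 : 0 < M :> R by rewrite ltr0n card_slice_gt0 // ltnW.
have /card_gt0P[x0 _] := card_slice_gt0 (ltnW k_lt_n).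
have -> : \sum_(x : slice n k) heat F t x = M * F 0 x0.
  rewrite exchange_big big_ord_recl /= [X in _ + X]big1 => [|d _]; last first.
    by rewrite -mulr_sumr (sum_level_eq0 fF) ?mulr0 //; exact: ltn_ord.
  rewrite addr0 rate0 mul0r oppr0 expR0.
  under eq_bigr do rewrite mul1r (level0_const _ x0 fF).
  by rewrite sumr_const -mulr_natl.
have -> : level F 0 = M * F 0 x0 ^+ 2.
  rewrite /level; under eq_bigr do rewrite (level0_const _ x0 fF).
  by rewrite sumr_const -mulr_natl.
by rewrite rate0 mul0r oppr0 expR0; field; rewrite gt_eqF.
Qed.

Lemma norm2_sqr f : norm 2 f ^+ 2 = (\sum_(x : slice n k) f x ^+ 2) / #|{: slice n k}|%:R.
Proof.
rewrite /norm -powR_mulrn ?powR_ge0 // -powRrM mulVf // powRr1; last first.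
  by rewrite divr_ge0 // sumr_ge0 // => x _; exact: powR_ge0.
rewrite /mean; congr (_ / _); apply: eq_bigr => x _.
by rewrite powR_mulrn // real_normK ?num_real.
Qed.

Lemma norm1E f : norm 1 f = (\sum_(x : slice n k) `|f x|) / #|{: slice n k}|%:R.
Proof.
rewrite /norm invr1 /mean; under eq_bigr do rewrite powRr1 //.
by rewrite powRr1 // divr_ge0 // sumr_ge0.
Qed.

Lemma dirichletE f F : is_decomposition f F ->
  dirichlet f = (\sum_(d < D) rate d.+1 * level F d.+1) / #|{: slice n k}|%:R.
Proof.
move=> fF; rewrite /dirichlet; set M := #|_|%:R.
have e := heat_energy 0 fF; rewrite (heat0 fF) in e.
rewrite (sum_pairs_sym (G := fun i j => \sum_(x : slice n k) Dtau i j f x ^+ 2)) in e.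
- under eq_bigr do under eq_bigr do rewrite norm2_sqr.
  under eq_bigr do rewrite -mulr_suml.
  rewrite -mulr_suml mulrA (mulfI _ e) ?pnatr_eq0 // big_ord_recl nu0 mul0r add0r.
  congr (_ / _); rewrite mulr_sumr; apply: eq_bigr => d _.
  by rewrite !mulr0 oppr0 expR0 mul1r /rate; ring.
- by move=> i j; apply: eq_bigr => x _; rewrite /Dtau switchC.
- by move=> i; rewrite big1 // => x _; rewrite /Dtau switch_same // subrr expr0n.
Qed.

Lemma poincare f : Defs.variance f <= dirichlet f.
Proof.
have [F fF] := decompositionP f.
rewrite -[in Defs.variance f](heat0 fF) (variance_heat _ fF) (dirichletE fF) mulr0.
rewrite ler_wpM2r ?invr_ge0 //; apply: ler_sum => d _.
rewrite mulr0 oppr0 expR0 ler_wpM2r ?level_ge0 //.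
by apply: le_trans (rate_ge (ltn_ord d)); rewrite ler1n.
Qed.

(** * Coordinate functions as test functions for the spectral gap *)

Definition coordinate i x : R := (val x i)%:R.

Let M_gt0 : 0 < #|{: slice n k}|%:R :> R.
Proof. by rewrite ltr0n card_slice_gt0 // ltnW. Qed.

Lemma mean_coordinate i : mean (coordinate i) = k%:R / n%:R.
Proof.
have mE j : mean (coordinate j) = mean (coordinate i).
  rewrite /mean -(sum_switch i j); congr (_ / _); apply: eq_bigr => x _.
  by rewrite /coordinate switchE tpermR.
have n_gt0 : (0 : R) < n%:R by rewrite ltr0n; lia.
apply: (mulIf (lt0r_neq0 n_gt0)); rewrite divfK ?gt_eqF //.
transitivity (\sum_(j < n) mean (coordinate j)).
  by under eq_bigr do rewrite mE; rewrite sumr_const card_ord mulr_natr.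
rewrite /mean -mulr_suml exchange_big /=.
rewrite (eq_bigr (fun=> k%:R)) => [|x _]; last first.
  by rewrite -[k in RHS](eqP (valP x)) natr_sum.
by rewrite sumr_const -[_ *+ #|_|]mulr_natr mulfK // gt_eqF.
Qed.

Lemma variance_coordinate i :
  Defs.variance (coordinate i) = k%:R / n%:R * (1 - k%:R / n%:R).
Proof.
rewrite /Defs.variance (_ : mean _ = mean (coordinate i)); last first.
  rewrite /mean; congr (_ / _); apply: eq_bigr => x _.
  by rewrite /coordinate; case: (val x i); rewrite ?expr1n ?expr0n.
by rewrite mean_coordinate; ring.
Qed.

Lemma variance_coordinate_gt0 i : 0 < Defs.variance (coordinate i).
Proof.
rewrite variance_coordinate mulr_gt0 ?divr_gt0 ?ltr0n ?subr_gt0 //; first by lia.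
by rewrite ltr_pdivrMr ?mul1r ?ltr_nat // ltr0n; lia.
Qed.

(** A switch of a and b changes the coordinate i only if i is a or b, and then by at most 1. Hence
    the bound 2 n / (n - 1) <= 4. *)
Lemma dirichlet_coordinate_le i : dirichlet (coordinate i) <= 4.
Proof.
rewrite /dirichlet mulrC ler_pdivrMr //.
apply: (@le_trans _ _ (\sum_(a < n) \sum_(b < n) ((a == i)%:R + (b == i)%:R))).
  apply: ler_sum => a _; rewrite big_mkcond; apply: ler_sum => b _.
  case: ifP => ab; last by rewrite addr_ge0.
  rewrite norm2_sqr ler_pdivrMr // mulr_natr -sumr_const; apply: ler_sum => x _.
  rewrite /Dtau /coordinate switchE; case: tpermP => [->|->|/eqP ai /eqP bi].
  - rewrite eqxx; case: (_ == _); do 2!case: (val x _);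
      rewrite /= ?subrr ?subr0 ?sub0r ?sqrrN ?expr1n ?expr0n //=; lra.
  - rewrite eqxx; case: (_ == _); do 2!case: (val x _);
      rewrite /= ?subrr ?subr0 ?sub0r ?sqrrN ?expr1n ?expr0n //=; lra.
  - by rewrite subrr expr0n addr_ge0.
under eq_bigr do rewrite big_split sumr_const card_ord /=.
have e : \sum_(b < n) (b == i)%:R = 1 :> R.
  by rewrite (bigD1 i) //= eqxx big1 ?addr0 // => b /negbTE ->.
rewrite big_split sumr_const card_ord sumrMnl /= !e.
have : (2 : R) <= n%:R by rewrite ler_nat; lia.
lra.
Qed.

Lemma spectral_gap_ge1 : 1 <= spectral_gap R n k.
Proof.
apply: ub_le_sup; last by move=> f /=; rewrite mul1r poincare.
pose i := Ordinal (ltn_trans k_gt0 k_lt_n).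
(* The supremum requires an upper bound of its set; a function of positive variance provides one. *)
exists (4 / Defs.variance (coordinate i)) => l /(_ (coordinate i)) h.
by rewrite ler_pdivlMr ?variance_coordinate_gt0 // (le_trans h) // dirichlet_coordinate_le.
Qed.

Lemma spectral_gap_le : spectral_gap R n k <= 4 / (k%:R / n%:R * (1 - k%:R / n%:R)).
Proof.
apply: ge_sup; first by exists 1 => f /=; rewrite mul1r poincare.
pose i := Ordinal (ltn_trans k_gt0 k_lt_n).
move=> l /(_ (coordinate i)) h; rewrite -(variance_coordinate i).
by rewrite ler_pdivlMr ?variance_coordinate_gt0 // (le_trans h) // dirichlet_coordinate_le.
Qed.

(** Since the gap is positive, t = - ln (1 - eta) / (2 gap) exists and [get] returns a solution;
    then eta = 1 - e^(- 2 gap t) <= 2 gap t. *)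
Lemma noise_timeP (eta : R) : 0 <= eta < 1 ->
  0 <= noise_time n k eta /\
  eta <= 2 * spectral_gap R n k * noise_time n k eta.
Proof.
move=> /andP[eta0 eta1]; have := spectral_gap_ge1; rewrite /noise_time.
set gap := spectral_gap R n k => gap1; set t := get _.
have gap_gt0 : 0 < gap by apply: lt_le_trans gap1.
have [t0 tE] : 0 <= t /\ expR (- 2 * gap * t) = 1 - eta.
  apply: (@getPex _ [set t : R | 0 <= t /\ expR (- 2 * gap * t) = 1 - eta]%classic).
  exists (- ln (1 - eta) / (2 * gap)); split.
    by rewrite divr_ge0 ?mulr_ge0 // ?(ltW gap_gt0) // oppr_ge0 ln_le0 // gerBl.
  rewrite (_ : - 2 * gap * _ = ln (1 - eta)) ?lnK ?posrE ?subr_gt0 //.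
  by field; rewrite gt_eqF.
by split=> //; have := expR_ge1Dx (- 2 * gap * t); rewrite tE; lra.
Qed.

(** * Log-convexity in time and interpolation *)

Lemma expR_interpolation (theta z : R) : 0 <= theta <= 1 ->
  expR (theta * z) <= theta * expR z + (1 - theta).
Proof.
move=> /andP[t0 t1]; set c := expR (theta * z).
have c0 : 0 <= c by exact: expR_ge0.
(* The tangent to exp at theta z is evaluated at z here and at 0 in [e2]; the convex combination of
   both is the claim. *)
have e1 : c * (1 + (1 - theta) * z) <= expR z.
  rewrite (_ : expR z = c * expR ((1 - theta) * z)); last first.
    by rewrite -expRD; congr expR; ring.
  by rewrite ler_wpM2l // expR_ge1Dx.
have e2 : c * (1 - theta * z) <= 1.
  rewrite [leRHS](_ : 1 = c * expR (- (theta * z))); last first.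
    by rewrite -expRD subrr expR0.
  by rewrite ler_wpM2l // expR_ge1Dx.
have := ler_wpM2l t0 e1; have := ler_wpM2l (_ : 0 <= 1 - theta) e2.
rewrite subr_ge0 => /(_ t1); lra.
Qed.

Lemma tail_eq0 F s t : tail F s = 0 -> tail F t = 0.
Proof.
move/eqP; rewrite psumr_eq0 => [/allP h|d _]; last first.
  by rewrite mulr_ge0 ?expR_ge0 ?level_ge0.
rewrite /tail big1 // => d _; have := h d (mem_index_enum d).
by rewrite /= mulf_eq0 expR_eq0 /= => /eqP ->; rewrite mulr0.
Qed.

(** Hoelder's inequality over the levels: after division by the ratio m of the tails at t and 0,
    [expR_interpolation] applies to each term, and the combined bounds sum to [tail F 0]. A tail
    vanishing at one time vanishes at all times. *)
Lemma tail_log_convex F (theta t : R) : 0 <= theta <= 1 ->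
  tail F (theta * t) <= tail F t `^ theta * tail F 0 `^ (1 - theta).
Proof.
move=> t01; have [F0|nz0] := eqVneq (tail F 0) 0.
  by rewrite (tail_eq0 _ F0) mulr_ge0 ?powR_ge0.
have nzt : tail F t != 0 by apply: contra_neq nz0 => /(tail_eq0 0).
have F0 : 0 < tail F 0 by rewrite lt_neqAle eq_sym nz0 tail_ge0.
have Ft : 0 < tail F t by rewrite lt_neqAle eq_sym nzt tail_ge0.
set m := tail F t / tail F 0; have m_gt0 : 0 < m by rewrite divr_gt0.
have -> : tail F t `^ theta * tail F 0 `^ (1 - theta) = expR (theta * ln m) * tail F 0.
  rewrite -{1}(divfK nz0 (tail F t)) -/m powRM ?ltW // -mulrA -powRD ?nz0 ?implybT //.
  by rewrite addrC subrK powRr1 ?ltW // /powR gt_eqF.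
apply: (@le_trans _ _ (expR (theta * ln m) *
   \sum_(d < D) (theta * (expR (- (rate d.+1 * t)) / m) + (1 - theta)) * level F d.+1)).
  rewrite mulr_sumr; apply: ler_sum => d _; rewrite [leRHS]mulrA ler_wpM2r ?level_ge0 //.
  have -> : - (rate d.+1 * (theta * t)) =
      theta * ln m + theta * (- (rate d.+1 * t) - ln m) by ring.
  rewrite expRD ler_wpM2l ?expR_ge0 //.
  apply: le_trans (expR_interpolation _ t01) _.
  by rewrite expRD (expRN (ln m)) lnK.
rewrite ler_wpM2l ?expR_ge0 // le_eqVlt; apply/orP; left; apply/eqP.
transitivity (theta / m * tail F t + (1 - theta) * tail F 0).
  rewrite /tail !mulr_sumr -big_split; apply: eq_bigr => d _ /=.
  by rewrite mulr0 oppr0 expR0; ring.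
rewrite /m; field; rewrite ?nzt ?nz0 //.
Qed.

Lemma tail_influence_mean f F (K s : R) : is_decomposition f F -> 0 <= K ->
    1 / 2 <= s -> 64 * K <= expR (4 * s) ->
    (forall d, (d <= D)%N ->
       9 ^+ d * 'C(n, k)%:R <= K ^+ d * 'C(n - 2 * d, k - d)%:R) ->
  (tail F (4 * s) / #|{: slice n k}|%:R) ^+ 2 <=
  8 * ((n%:R - 1)^-1 * \sum_(i < n) \sum_(j < n | (i < j)%N) influence i j f ^+ 2) *
  norm 2 f ^+ 2.
Proof.
move=> fF K0 s12 Ks HK; have := tail_influence fF K0 s12 Ks HK.
rewrite norm2_sqr; set M := #|_|%:R; set S := \sum_(x : slice n k) f x ^+ 2.
rewrite (sum_pairs_sym (G := fun i j => (\sum_(x : slice n k) `|Dtau i j f x|) ^+ 2)).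
- under [X in _ -> _ <= _ * (_ * X) * _]eq_bigr do under eq_bigr do rewrite /influence norm1E expr_div_n.
  under [X in _ -> _ <= _ * (_ * X) * _]eq_bigr do rewrite -mulr_suml.
  rewrite -mulr_suml -/M; set N := \sum_(i < n) _; set T := tail F _ => h.
  have MM : 0 < M ^+ 3 * (n%:R - 1) by rewrite mulr_gt0 ?exprn_gt0.
  rewrite -(ler_pM2l MM); move: h; congr (is_true (_ <= _)).
    by field; rewrite gt_eqF.
  by field; rewrite !gt_eqF.
- by move=> i j; congr (_ ^+ 2); apply: eq_bigr => x _; rewrite /Dtau switchC.
- move=> i; rewrite big1 ?expr0n // => x _.
  by rewrite /Dtau switch_same // subrr normr0.
Qed.

(** Interpolates with theta = 2 a between the influence bound on the tail at 4 s and the L^2 bound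
    at 0. The tail is taken at twice the noise time, hence the requirement on 4 a s. *)
Lemma noise_stability_le f (eta a K s : R) : 0 <= eta < 1 -> 0 <= K ->
    1 / 2 <= s -> 64 * K <= expR (4 * s) ->
    (forall d, (d <= D)%N ->
       9 ^+ d * 'C(n, k)%:R <= K ^+ d * 'C(n - 2 * d, k - d)%:R) ->
    0 <= a <= 1 / 2 -> 4 * a * s <= noise_time n k eta ->
  noise_stability eta f <=
  7 * ((n%:R - 1)^-1 * \sum_(i < n) \sum_(j < n | (i < j)%N) influence i j f ^+ 2) `^ a
    * norm 2 f `^ (2 - 2 * a).
Proof.
move=> eta01 K0 s12 Ks HK /andP[a0 a12] tge; have [F fF] := decompositionP f.
set X := (n%:R - 1)^-1 * _; set N := norm 2 f; set t := noise_time n k eta in tge.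
have X0 : 0 <= X.
  rewrite mulr_ge0 ?invr_ge0 //; apply: sumr_ge0 => i _.
  by apply: sumr_ge0 => j _; exact: sqr_ge0.
have N0 : 0 <= N by exact: powR_ge0.
rewrite /noise_stability -/t (semigroupE _ fF) (variance_heat _ fF).
set M := #|_|%:R.
have s0 : 0 <= s by apply: le_trans s12; lra.
have theta01 : 0 <= 2 * a <= 1 by apply/andP; split; lra.
(* The 7 comes from 8 <= 7^2; raised to the power 2 a <= 1 it stays at most 7. *)
have V4 : tail F (4 * s) / M <= 7 * (X `^ 2^-1 * N).
  rewrite -ler_sqr ?nnegrE ?divr_ge0 ?tail_ge0 ?mulr_ge0 ?powR_ge0 //.
  apply: le_trans (tail_influence_mean fF K0 s12 Ks HK) _; rewrite -/X -/N.
  rewrite !exprMn -[X `^ _ ^+ 2]powR_mulrn ?powR_ge0 // -powRrM mulVf // powRr1 //.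
  by rewrite mulrA ler_wpM2r ?sqr_ge0 // ler_wpM2r //; lra.
have V0 : tail F 0 / M <= N `^ 2.
  rewrite powR_mulrn // norm2_sqr ler_wpM2r ?invr_ge0 //.
  exact: tail_le fF (lexx 0).
have Minv : 0 <= M^-1 by rewrite invr_ge0 ltW.
have split_M : M^-1 = M^-1 `^ (2 * a) * M^-1 `^ (1 - 2 * a).
  rewrite -powRD; first by rewrite addrC subrK powRr1.
  by rewrite invr_neq0 ?implybT // gt_eqF.
apply: (@le_trans _ _ (tail F (2 * a * (4 * s)) / M)).
  by rewrite ler_wpM2r // tail_homo //; lra.
apply: (@le_trans _ _ ((tail F (4 * s) / M) `^ (2 * a) * (tail F 0 / M) `^ (1 - 2 * a))).
  rewrite !powRM ?tail_ge0 // [leRHS]mulrACA -split_M ler_wpM2r //.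
  exact: tail_log_convex.
apply: (@le_trans _ _ ((7 * (X `^ 2^-1 * N)) `^ (2 * a) * (N `^ 2) `^ (1 - 2 * a))).
  have V_ge0 u : 0 <= tail F u / M by rewrite divr_ge0 ?tail_ge0.
  apply: ler_pM; [exact: powR_ge0 | exact: powR_ge0 | |].
    apply: ge0_ler_powR V4; first by lra.
      by rewrite nnegrE.
    by rewrite nnegrE mulr_ge0 // mulr_ge0 ?powR_ge0.
  by apply: ge0_ler_powR V0; rewrite ?nnegrE ?powR_ge0 //; lra.
clearbody X N.
rewrite !powRM ?mulr_ge0 ?powR_ge0 // -!powRrM mulKf //.
rewrite -!mulrA -powRD; last first.
  (* The total exponent 2 - 2 a is nonzero, which covers the case N = 0. *)
  by apply/implyP => /eqP e; exfalso; lra.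
rewrite (_ : 2 * a + 2 * (1 - 2 * a) = 2 - 2 * a); last by ring.
by rewrite ler_wpM2r ?mulr_ge0 ?powR_ge0 // ler1_powR //; lra.
Qed.

End Heat.

(** * Choice of the constants *)

Theorem mainTheorem6 (R : realType) (c' : R) (hc' : 0 < c' < 1 / 2) :
  exists c : R, 0 < c /\
    forall (n k : nat), (2 <= n)%N -> (1 <= k)%N -> (k < n)%N ->
      c' * n%:R <= k%:R -> k%:R <= (1 - c') * n%:R ->
    forall (f : slice n k -> R) (eta : R), 0 <= eta -> eta < 1 ->
      noise_stability eta f <=
        7 * ((n%:R - 1)^-1 *
               \sum_(i < n) \sum_(j < n | (i < j)%N) influence i j f ^+ 2)
              `^ (c * eta)
          * norm 2 f `^ (2 - 2 * c * eta).
Proof.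
have /andP[c'_gt0 c'_lt] := hc'.
(* [K] is 9, the loss per degree in [bonami_eigen], times 2 e n / min(k, n - k),
   the loss per degree in [bin_ratio]. *)
set K : R := 18 * expR 1 / c'; set s := 64 * K; set v := c' * (1 - c').
have e1 : 1 <= expR 1 :> R by rewrite -[leLHS]expR0 ler_expR.
have K1 : 1 <= K by rewrite /K ler_pdivlMr //; lra.
have s_ge : 64 <= s by rewrite /s; lra.
have s_gt0 : 0 < s by lra.
have v_gt0 : 0 < v by rewrite /v mulr_gt0 //; lra.
have v1 : v <= 1 by rewrite /v; nra.
(* With p = k / n one has v <= p (1 - p), so the gap is at most 4 / v and eta <= 2 gap t gives v eta
   <= 8 t. The factor 32 s makes 4 a s equal to v eta / 8, hence at most the noise time. *)
exists (v / (32 * s)); split; first by rewrite divr_gt0 //; lra.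
move=> n k n2 k1 kn ck kc f eta eta0 eta1.
have n_gt0 : (0 : R) < n%:R by rewrite ltr0n; lia.
have HK d : (d <= minn k (n - k))%N ->
    9 ^+ d * 'C(n, k)%:R <= K ^+ d * 'C(n - 2 * d, k - d)%:R.
  move=> dD; have := bin_ratio (R := R) (leqnn n) (ltnW kn) dD.
  set m : R := (minn k (n - k))%:R => h.
  have mn : c' * n%:R <= m.
    rewrite /m /minn; case: ifP => // _; rewrite natrB; last exact: ltnW.
    by move: kc; rewrite mulrBl mul1r; lra.
  have m_gt0 : 0 < m by apply: lt_le_trans mn; rewrite mulr_gt0.
  rewrite -(ler_pM2r (exprn_gt0 d m_gt0)) -mulrA.
  apply: le_trans (ler_wpM2l (exprn_ge0 d (ler0n R 9)) h) _.
  rewrite mulrA -exprMn [leRHS]mulrAC -exprMn ler_wpM2r //.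
  apply: lerXn2r; rewrite ?nnegrE.
  - by rewrite !mulr_ge0 ?expR_ge0 // ltW.
  - by rewrite mulr_ge0 // ltW //; lra.
  - rewrite /K [leRHS]mulrAC ler_pdivlMr //.
    rewrite [leLHS](_ : _ = 18 * expR 1 * (c' * n%:R)); last by ring.
    by rewrite ler_wpM2l // mulr_ge0 ?expR_ge0.
(* With s = 64 K the crude bound e^(4 s) >= 1 + 4 s suffices. *)
have Ks : 64 * K <= expR (4 * s).
  by apply: le_trans (expR_ge1Dx _); rewrite -/s; lra.
set a := v / (32 * s) * eta.
have cE : v / (32 * s) <= 1 / 2 by rewrite ler_pdivrMr; lra.
have c0 : 0 <= v / (32 * s) by apply: divr_ge0; lra.
rewrite -[2 * _ * eta]mulrA -/a.
apply: (@noise_stability_le R n k k1 kn f eta a K s) => //.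
- by rewrite eta0.
- by apply: le_trans K1; lra.
- by lra.
- by apply/andP; split; rewrite /a; nra.
have [t0 eta_le] := noise_timeP k1 kn (introT andP (conj eta0 eta1)).
set t := noise_time n k eta in t0 eta_le *.
have gap_ge := @spectral_gap_ge1 R n k k1 kn; have gap_le := @spectral_gap_le R n k k1 kn.
set gap := spectral_gap R n k in gap_ge gap_le eta_le.
set p : R := k%:R / n%:R in gap_le.
have pv : v <= p * (1 - p).
  have : c' <= p by rewrite /p ler_pdivlMr.
  have : p <= 1 - c' by rewrite /p ler_pdivrMr.
  by rewrite /v; nra.
have gap_v : gap * v <= 4.
  have p_gt0 : 0 < p * (1 - p) by apply: lt_le_trans pv.
  by move: gap_le; rewrite ler_pdivlMr //; apply: le_trans; rewrite ler_wpM2l //; lra.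
have -> : 4 * a * s = v * eta / 8 by rewrite /a; field; rewrite gt_eqF.
rewrite ler_pdivrMr //; apply: (@le_trans _ _ (v * (2 * gap * t))).
  by rewrite ler_wpM2l // ltW.
by have := ler_wpM2r t0 gap_v; lra.
Qed.
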